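(* Let $(W,S)$ be a finite Coxeter group, $R$ a commutative ring, $(q_s)_{s\in S}$ a family of invertible elements of $R$ with $q_s=q_t$ whenever $s,t\in S$ are $W$-conjugate, and $\mathcal{H}$ the associated Hecke algebra over $R$. Let $I_0\subseteq S$. Then the restriction of $X(\mathcal{H})$ to $\mathcal{H}\otimes_R(\mathcal{H}_{I_0})^\circ$ is isomorphic to $\mathcal{H}\otimes_{\mathcal{H}_{I_0}}X(\mathcal{H}_{I_0})$ in $\mathbf{K}^{\mathbf b}(\mathcal{H}\otimes_R(\mathcal{H}_{I_0})^\circ)$.
   Context: Hecke algebra: $\mathcal{H}=\bigoplus_{w\in W}Rh_w$ is the $R$-free associative algebra with $h_wh_{w'}=h_{ww'}$ whenever $l(ww')=l(w)+l(w')$ ($l$ the length with respect to $S$), and $(h_s)^2=(q_s-1)h_s+q_s$ for $s\in S$. For $I\subseteq S$, $W_I=\langle I\rangle$ and $\mathcal{H}_I=\bigoplus_{w\in W_I}Rh_w$, a subalgebra which is the Hecke algebra of $(W_I,I)$ with parameters $(q_s)_{s\in I}$. Complexes: for a ring $A$, $A^\circ$ is the opposite ring and $\mathbf{K}^{\mathbf b}(A)$ is the homotopy category of bounded cochain complexes of finitely generated left $A$-modules; modules over $A\otimes_R B^\circ$ are $A,B$-bimodules (with $R$ acting centrally). A coefficient system on the set $2^S$ of subsets of $S$ is a family of modules $(M^I)_{I\subseteq S}$ with restriction maps $\varphi_{JI}:M^I\to M^J$ for $I\subseteq J$ satisfying $\varphi_{KJ}\varphi_{JI}=\varphi_{KI}$.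 Fixing a total order on $S$ and letting $n(I,s)$ be the number of elements of $I$ that are $<s$, its associated complex has $\bigoplus_{|I|=i}M^I$ in degree $i$ and differential $\sum_{s\in S\setminus I}(-1)^{n(I,s)}\varphi_{I\cup\{s\},I}$ on $M^I$. $X(\mathcal{H})$ is the complex of $\mathcal{H}$-bimodules associated with the coefficient system on $2^S$ given by $X(\mathcal{H})^I=\mathcal{H}\otimes_{\mathcal{H}_I}\mathcal{H}$ and $\varphi_{JI}(h\otimes_{\mathcal{H}_I}h')=h\otimes_{\mathcal{H}_J}h'$ for $I\subseteq J$. $X(\mathcal{H}_{I_0})$ is the same construction for $\mathcal{H}_{I_0}$ and $(W_{I_0},I_0)$. *)

(* Defs.v *)
From HB Require Import structures.
From mathcomp Require Import all_boot all_fingroup all_algebra.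
From mathcomp Require Import ring_quotient boolp zify.
From mathcomp Require Import freeg.

Set Implicit Arguments.
Unset Strict Implicit.
Unset Printing Implicit Defensive.

Import GRing.Theory.
Local Open Scope ring_scope.

Lemma zmod_morph0 (U V : zmodType) (f : U -> V) : zmod_morphism f -> f 0 = 0.
Proof. by move=> fB; have := fB 0 0; rewrite !subrr. Qed.

Lemma zmod_morphD (U V : zmodType) (f : U -> V) :
  zmod_morphism f -> {morph f : x y / x + y}.
Proof.
move=> fB x y; have fN : f (- y) = - f y.
  by rewrite -[- y]add0r fB zmod_morph0 // add0r.
by rewrite -[y in LHS]opprK fB fN opprK.
Qed.

Section Bimodules.
Variable R : comNzRingType.

(* [A,B]-bimodules on which [R] acts centrally, i.e. left modules over
   [A (x)_R B^op]. *)
Record bimodule (A B : algType R) := Bimodule {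
  bm_sort :> zmodType;
  lact : A -> bm_sort -> bm_sort;
  ract : bm_sort -> B -> bm_sort;
  lact1 : forall x, lact 1 x = x;
  lactM : forall a a' x, lact (a * a') x = lact a (lact a' x);
  lactDl : forall a a' x, lact (a + a') x = lact a x + lact a' x;
  lactDr : forall a x y, lact a (x + y) = lact a x + lact a y;
  ract1 : forall x, ract x 1 = x;
  ractM : forall x b b', ract x (b * b') = ract (ract x b) b';
  ractDl : forall x y b, ract (x + y) b = ract x b + ract y b;
  ractDr : forall x b b', ract x (b + b') = ract x b + ract x b';
  lractA : forall a x b, ract (lact a x) b = lact a (ract x b);
  lractC : forall (r : R) x, lact (r%:A) x = ract x (r%:A)
}.

Record bimodHom (A B : algType R) (M N : bimodule A B) := BimodHom {
  bm_fun :> {additive M -> N};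
  bm_funl : forall a x, bm_fun (lact a x) = lact a (bm_fun x);
  bm_funr : forall x b, bm_fun (ract x b) = ract (bm_fun x) b
}.

Definition regular_bimodule (A : algType R) : bimodule A A.
Proof.
exists A (fun a x => a * x) (fun x b => x * b).
- exact: mul1r.
- by move=> *; rewrite mulrA.
- by move=> *; rewrite mulrDl.
- by move=> *; rewrite mulrDr.
- exact: mulr1.
- by move=> *; rewrite mulrA.
- by move=> *; rewrite mulrDl.
- by move=> *; rewrite mulrDr.
- by move=> *; rewrite mulrA.
- by move=> r x; rewrite mulr_algl mulr_algr.
Defined.

Definition restrict (A A' B B' : algType R)
  (f : {lrmorphism A' -> A}) (g : {lrmorphism B' -> B}) (M : bimodule A B) :
  bimodule A' B'.
Proof.
exists M (fun a x => lact (f a) x) (fun x b => ract x (g b)).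
- by move=> x; rewrite rmorph1 lact1.
- by move=> a a' x; rewrite rmorphM lactM.
- by move=> a a' x; rewrite rmorphD lactDl.
- by move=> a x y; rewrite lactDr.
- by move=> x; rewrite rmorph1 ract1.
- by move=> x b b'; rewrite rmorphM ractM.
- by move=> x y b; rewrite ractDl.
- by move=> x b b'; rewrite rmorphD ractDr.
- by move=> a x b; rewrite lractA.
- by move=> r x; rewrite !linearZ /= !rmorph1 lractC.
Defined.

End Bimodules.

Section DirectSum.
Variables (R : comNzRingType) (A B : algType R) (K : finType).
Variable M : K -> bimodule A B.

(* As [K] is finite, the direct sum is the product. *)
Definition dsum_type : Type := {dffun forall k, M k}.
HB.instance Definition _ := Choice.on dsum_type.

Definition mk_dsum (x : forall k, M k) : dsum_type := finfun x.
Definition dsum_coord (x : dsum_type) k : M k := x k.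

Lemma mk_dsumE x k : dsum_coord (mk_dsum x) k = x k.
Proof. by rewrite /dsum_coord ffunE. Qed.

Lemma dsumP (x y : dsum_type) :
  (forall k, dsum_coord x k = dsum_coord y k) -> x = y.
Proof. by move=> e; apply/ffunP. Qed.

Definition dsum_add (x y : dsum_type) :=
  mk_dsum (fun k => dsum_coord x k + dsum_coord y k).
Definition dsum_opp (x : dsum_type) := mk_dsum (fun k => - dsum_coord x k).
Definition dsum_zero := mk_dsum (fun k => 0).

Lemma dsum_addA : associative dsum_add.
Proof. by move=> x y z; apply: dsumP => k; rewrite !mk_dsumE addrA. Qed.
Lemma dsum_addC : commutative dsum_add.
Proof. by move=> x y; apply: dsumP => k; rewrite !mk_dsumE addrC. Qed.
Lemma dsum_add0 : left_id dsum_zero dsum_add.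
Proof. by move=> x; apply: dsumP => k; rewrite !mk_dsumE add0r. Qed.
Lemma dsum_addN : left_inverse dsum_zero dsum_opp dsum_add.
Proof. by move=> x; apply: dsumP => k; rewrite !mk_dsumE addNr. Qed.

HB.instance Definition _ :=
  GRing.isZmodule.Build dsum_type dsum_addA dsum_addC dsum_add0 dsum_addN.

Lemma dsum_coordD x y k :
  dsum_coord (x + y) k = dsum_coord x k + dsum_coord y k.
Proof. exact: mk_dsumE. Qed.

Lemma dsum_coordB x y k :
  dsum_coord (x - y) k = dsum_coord x k - dsum_coord y k.
Proof. by rewrite dsum_coordD; congr (_ + _); exact: mk_dsumE. Qed.

Definition direct_sum : bimodule A B.
Proof.
exists dsum_type (fun a x => mk_dsum (fun k => lact a (dsum_coord x k)))
                 (fun x b => mk_dsum (fun k => ract (dsum_coord x k) b)).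
all: move=> *; apply: dsumP => k; rewrite !(mk_dsumE, dsum_coordD).
- exact: lact1.
- exact: lactM.
- exact: lactDl.
- exact: lactDr.
- exact: ract1.
- exact: ractM.
- exact: ractDl.
- exact: ractDr.
- exact: lractA.
- exact: lractC.
Defined.

End DirectSum.

Section Additivity.
Variables (R : comNzRingType) (A B : algType R) (M : bimodule A B).

Lemma lactBr a : zmod_morphism (@lact _ _ _ M a).
Proof.
move=> x y; apply: (addIr (lact a y)).
by rewrite -lactDr !subrK.
Qed.

Lemma ractBl b : zmod_morphism ((@ract _ _ _ M)^~ b).
Proof.
move=> x y /=; apply: (addIr (ract y b)).
by rewrite -ractDl !subrK.
Qed.

HB.instance Definition _ a :=
  GRing.isZmodMorphism.Build M M (@lact _ _ _ M a) (@lactBr a).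

Definition ractr b (x : M) := ract x b.
HB.instance Definition _ b :=
  GRing.isZmodMorphism.Build M M (ractr b) (@ractBl b).

End Additivity.

Section Tensor.
Variables (R : comNzRingType) (A B C : algType R).
Variables (M : bimodule A B) (N : bimodule B C).

Notation formal := {freeg (M * N)%type}.
Definition formal_tensor (x : M) (y : N) : formal := [freeg [:: (1, (x, y))]].

Inductive tensor_null : formal -> Prop :=
| tensor_null0 : tensor_null 0
| tensor_nullB u v : tensor_null u -> tensor_null v -> tensor_null (u - v)
| tensor_nullDl x x' y : tensor_null
    (formal_tensor (x + x') y - (formal_tensor x y + formal_tensor x' y))
| tensor_nullDr x y y' : tensor_null
    (formal_tensor x (y + y') - (formal_tensor x y + formal_tensor x y'))
| tensor_nullM x b y : tensor_null
    (formal_tensor (ract x b) y - formal_tensor x (lact b y)).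

Definition tensor_nullp : {pred formal} := fun u => `[< tensor_null u >].

Lemma tensor_nullp_closed : zmod_closed tensor_nullp.
Proof.
split=> [|u v /asboolP hu /asboolP hv]; apply/asboolP.
  exact: tensor_null0.
exact: tensor_nullB.
Qed.
Definition tensor_nulls : zmodClosed formal :=
  HB.pack tensor_nullp (GRing.isZmodClosed.Build formal _ tensor_nullp_closed).

Definition tensor_type : zmodType := Quotient.quot tensor_nulls.

Definition tens (x : M) (y : N) : tensor_type :=
  (\pi_(Quotient.quot tensor_nulls) (formal_tensor x y))%qT.

Lemma tensDl x x' y : tens (x + x') y = tens x y + tens x' y.
Proof.
rewrite /tens -raddfD; apply/eqP; rewrite -Quotient.idealrBE.
exact/asboolP/tensor_nullDl.
Qed.

Lemma tensDr x y y' : tens x (y + y') = tens x y + tens x y'.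
Proof.
rewrite /tens -raddfD; apply/eqP; rewrite -Quotient.idealrBE.
exact/asboolP/tensor_nullDr.
Qed.

Lemma tensM x b y : tens (ract x b) y = tens x (lact b y).
Proof.
rewrite /tens; apply/eqP; rewrite -Quotient.idealrBE.
exact/asboolP/tensor_nullM.
Qed.

Lemma tens_ind (P : tensor_type -> Prop) :
  P 0 -> (forall u v, P u -> P v -> P (u - v)) -> (forall x y, P (tens x y)) ->
  forall t, P t.
Proof.
move=> P0 PB Pt; elim/quotW=> u.
have PN v : P v -> P (- v) by move=> Pv; rewrite -[- v]add0r; apply: PB.
have PD v w : P v -> P w -> P (v + w).
  by move=> Pv Pw; rewrite -[w]opprK; apply: PB => //; apply: PN.
rewrite -(Freeg_dom u); elim: (dom u) => [|k l IHl] /=.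
  by rewrite freeg_nil raddf0.
rewrite (freeg_cat [:: _]) raddfD; apply: (PD _ _ _ IHl).
have -> : [freeg [:: (coeff k u, k)]] = formal_tensor k.1 k.2 *~ coeff k u.
  by rewrite freegU_mulz intz; case: k.
rewrite raddfMz -/(tens _ _); case: (coeff k u) => n.
  rewrite -pmulrn; elim: n => [|n IHn]; first by rewrite mulr0n.
  by rewrite mulrS; exact: (PD _ _ (Pt _ _) IHn).
rewrite NegzE mulrNz; apply: PN; rewrite -pmulrn.
by elim: n => [|n IHn]; [exact: Pt | rewrite mulrS; exact: (PD _ _ (Pt _ _) IHn)].
Qed.

Record balanced (V : zmodType) (f : M -> N -> V) : Prop := Balanced {
  balancedDl : forall x x' y, f (x + x') y = f x y + f x' y;
  balancedDr : forall x y y', f x (y + y') = f x y + f x y';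
  balancedM : forall x b y, f (ract x b) y = f x (lact b y)
}.

Lemma tens_balanced : balanced tens.
Proof. by split; [exact: tensDl | exact: tensDr | exact: tensM]. Qed.

Section Lift.
Variables (V : zmodType) (f : M -> N -> V).

Definition formal_lift : formal -> V :=
  @fglift int (zmodule V) _ (fun p => f p.1 p.2 : zmodule V).

Definition tens_lift (t : tensor_type) : V := formal_lift (generic_quotient.repr t).

Hypothesis hf : balanced f.

Lemma formal_liftB : zmod_morphism formal_lift.
Proof. exact: (@lift_is_additive int _ (zmodule V)). Qed.

Lemma formal_liftT x y : formal_lift (formal_tensor x y) = f x y.
Proof. by rewrite /formal_lift liftU scale1r. Qed.

Lemma formal_lift_null u : tensor_null u -> formal_lift u = 0.
Proof.
have LD := zmod_morphD formal_liftB.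
by elim=> [|v w _ v0 _ w0|x x' y|x y y'|x b y];
  rewrite ?(zmod_morph0 formal_liftB) // formal_liftB ?LD ?formal_liftT ?v0 ?w0
    ?(balancedDl hf) ?(balancedDr hf) ?(balancedM hf) ?subrr.
Qed.

Lemma tens_lift_pi u : tens_lift (\pi_(Quotient.quot tensor_nulls) u)%qT =
  formal_lift u.
Proof.
apply/eqP; rewrite -subr_eq0 -formal_liftB; apply/eqP/formal_lift_null/asboolP.
by rewrite -[asbool _]/(_ \in tensor_nulls) Quotient.idealrBE reprK.
Qed.

Lemma tens_liftE x y : tens_lift (tens x y) = f x y.
Proof. by rewrite tens_lift_pi formal_liftT. Qed.

Lemma tens_liftB : zmod_morphism tens_lift.
Proof.
elim/quotW=> u; elim/quotW=> v.
by rewrite -raddfB !tens_lift_pi formal_liftB.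
Qed.

Lemma tens_liftD : {morph tens_lift : t u / t + u}.
Proof. exact: zmod_morphD tens_liftB. Qed.

End Lift.

Lemma eq_additive_tens (V : zmodType) (f g : tensor_type -> V) :
  zmod_morphism f -> zmod_morphism g ->
  (forall x y, f (tens x y) = g (tens x y)) -> f =1 g.
Proof.
move=> fB gB e; elim/tens_ind=> [|u v eu ev|//].
  by rewrite !zmod_morph0.
by rewrite fB gB eu ev.
Qed.

End Tensor.

Section TensorBimodule.
Variables (R : comNzRingType) (A B C : algType R).
Variables (M : bimodule A B) (N : bimodule B C).
Local Notation T := (tensor_type M N).

Definition tens_lact (a : A) : T -> T := tens_lift (fun x y => tens (lact a x) y).
Definition tens_ract (t : T) (c : C) : T :=
  tens_lift (fun x y => tens x (ract y c)) t.

Lemma tens_lact_balanced a : balanced (fun (x : M) (y : N) => tens (lact a x) y).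
Proof.
split=> [x x' y|x y y'|x b y].
- by rewrite lactDr tensDl.
- by rewrite tensDr.
- by rewrite -lractA tensM.
Qed.

Lemma tens_ract_balanced c : balanced (fun (x : M) (y : N) => tens x (ract y c)).
Proof.
split=> [x x' y|x y y'|x b y].
- by rewrite tensDl.
- by rewrite ractDl tensDr.
- by rewrite tensM lractA.
Qed.

Lemma tens_lactE a x y : tens_lact a (tens x y) = tens (lact a x) y.
Proof. by rewrite /tens_lact (tens_liftE (tens_lact_balanced a)). Qed.

Lemma tens_ractE c x y : tens_ract (tens x y) c = tens x (ract y c).
Proof. by rewrite /tens_ract (tens_liftE (tens_ract_balanced c)). Qed.

Lemma tens_lactB a : zmod_morphism (tens_lact a).
Proof. exact: tens_liftB (tens_lact_balanced a). Qed.

Lemma tens_ractB c : zmod_morphism (tens_ract^~ c).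
Proof. exact: tens_liftB (tens_ract_balanced c). Qed.

Definition tensor : bimodule A C.
Proof.
exists T tens_lact tens_ract.
- elim/tens_ind=> [|u v eu ev|x y]; first exact: zmod_morph0 (tens_lactB 1).
    by rewrite tens_lactB eu ev.
  by rewrite tens_lactE lact1.
- move=> a a'; elim/tens_ind=> [|u v eu ev|x y].
  + by rewrite !(zmod_morph0 (tens_lactB _)).
  + by rewrite !tens_lactB eu ev.
  + by rewrite !tens_lactE lactM.
- move=> a a'; elim/tens_ind=> [|u v eu ev|x y].
  + by rewrite !(zmod_morph0 (tens_lactB _)) addr0.
  + by rewrite !tens_lactB eu ev opprD addrACA.
  + by rewrite !tens_lactE lactDl tensDl.
- by move=> a; exact: zmod_morphD (tens_lactB a).
- elim/tens_ind=> [|u v eu ev|x y]; first exact: zmod_morph0 (tens_ractB 1).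
    by rewrite tens_ractB eu ev.
  by rewrite tens_ractE ract1.
- move=> t c c'; elim/tens_ind: t => [|u v eu ev|x y].
  + by rewrite !(zmod_morph0 (tens_ractB _)).
  + by rewrite !tens_ractB eu ev.
  + by rewrite !tens_ractE ractM.
- by move=> x y c; exact: zmod_morphD (tens_ractB c) x y.
- move=> t c c'; elim/tens_ind: t => [|u v eu ev|x y].
  + by rewrite !(zmod_morph0 (tens_ractB _)) addr0.
  + by rewrite !tens_ractB eu ev opprD addrACA.
  + by rewrite !tens_ractE ractDr tensDr.
- move=> a t c; elim/tens_ind: t => [|u v eu ev|x y].
  + by rewrite !(zmod_morph0 (tens_lactB _), zmod_morph0 (tens_ractB _)).
  + by rewrite !(tens_lactB, tens_ractB) eu ev.
  + by rewrite !(tens_lactE, tens_ractE).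
- move=> r; elim/tens_ind=> [|u v eu ev|x y].
  + by rewrite (zmod_morph0 (tens_lactB _)) (zmod_morph0 (tens_ractB _)).
  + by rewrite tens_lactB tens_ractB eu ev.
  + by rewrite tens_lactE tens_ractE lractC tensM lractC.
Defined.

End TensorBimodule.

Section TensorHom.
Variables (R : comNzRingType) (A B C : algType R).
Variables (M : bimodule A B) (N N' : bimodule B C) (f : bimodHom N N').

Definition tens_hom_fun : tensor M N -> tensor M N' :=
  tens_lift (fun (x : M) (y : N) => tens x (f y)).

Lemma tens_hom_balanced : balanced (fun (x : M) (y : N) => tens x (f y)).
Proof.
split=> [x x' y|x y y'|x b y].
- by rewrite tensDl.
- by rewrite raddfD tensDr.
- by rewrite bm_funl tensM.
Qed.

Lemma tens_homE (x : M) (y : N) : tens_hom_fun (tens x y) = tens x (f y).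
Proof. by rewrite /tens_hom_fun (tens_liftE tens_hom_balanced). Qed.

Lemma tens_homB : zmod_morphism tens_hom_fun.
Proof. exact: tens_liftB tens_hom_balanced. Qed.

HB.instance Definition _ :=
  GRing.isZmodMorphism.Build (tensor M N) (tensor M N') tens_hom_fun tens_homB.

Definition tensor_hom : bimodHom (tensor M N) (tensor M N').
Proof.
exists tens_hom_fun.
- move=> a; apply: eq_additive_tens => [t u|t u|x y] /=.
  + by rewrite tens_lactB tens_homB.
  + by rewrite tens_homB tens_lactB.
  + by rewrite tens_lactE !tens_homE tens_lactE.
- move=> t c; move: t; apply: eq_additive_tens => [t u|t u|x y] /=.
  + by rewrite tens_ractB tens_homB.
  + by rewrite tens_homB tens_ractB.
  + by rewrite tens_ractE !tens_homE bm_funr tens_ractE.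
Defined.

End TensorHom.

Section Complexes.
Variables (R : comNzRingType) (A B : algType R).

Record complex := Complex {
  cx_obj :> int -> bimodule A B;
  cx_d : forall i, bimodHom (cx_obj i) (cx_obj (i + 1));
  cx_dd : forall i x, cx_d (i + 1) (cx_d i x) = 0
}.

Record chainMap (C D : complex) := ChainMap {
  cm_fun :> forall i, bimodHom (C i) (D i);
  cm_comm : forall i x, cm_fun (i + 1) (cx_d C i x) = cx_d D i (cm_fun i x)
}.

Definition chain_id (C : complex) : chainMap C C.
Proof.
by exists (fun i => @BimodHom R A B (C i) (C i) idfun
                      (fun _ _ => erefl) (fun _ _ => erefl)).
Defined.

Definition chain_comp (C D E : complex) (g : chainMap D E) (f : chainMap C D) :
  chainMap C E.
Proof.
unshelve eexists.
- move=> i; exists (g i \o f i) => [a x|x b] /=; first by rewrite !bm_funl.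
  by rewrite !bm_funr.
- by move=> i x /=; rewrite !cm_comm.
Defined.

(* The homotopy goes from degree [i + 1] to degree [i], and the condition is
   stated in degree [i + 1]; every integer is of this form. *)
Definition homotopic (C D : complex) (f g : chainMap C D) : Prop :=
  exists h : forall i, bimodHom (C (i + 1)) (D i), forall i x,
    f (i + 1) x - g (i + 1) x = cx_d D i (h i x) + h (i + 1) (cx_d C (i + 1) x).

Definition bounded (C : complex) : Prop :=
  exists n : nat, forall i : int, (n < `|i|)%N -> forall x : C i, x = 0.

Definition is_subbimodule (M : bimodule A B) (P : M -> Prop) : Prop :=
  [/\ P 0, forall x y, P x -> P y -> P (x + y), forall a x, P x -> P (lact a x)
    & forall x b, P x -> P (ract x b)].

Definition finitely_generated (M : bimodule A B) : Prop :=
  exists g : seq M, forall P : M -> Prop, is_subbimodule P ->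
    (forall x, x \in g -> P x) -> forall x, P x.

Definition Kb_object (C : complex) : Prop :=
  bounded C /\ forall i, finitely_generated (C i).

Definition Kb_isomorphic (C D : complex) : Prop :=
  [/\ Kb_object C, Kb_object D & exists (f : chainMap C D) (g : chainMap D C),
    homotopic (chain_comp g f) (chain_id C) /\
    homotopic (chain_comp f g) (chain_id D)].

End Complexes.

Section RestrictTensorComplex.
Variables (R : comNzRingType).

Definition restrict_hom (A A' B B' : algType R)
  (f : {lrmorphism A' -> A}) (g : {lrmorphism B' -> B}) (M N : bimodule A B)
  (u : bimodHom M N) : bimodHom (restrict f g M) (restrict f g N) :=
  @BimodHom R A' B' (restrict f g M) (restrict f g N) (bm_fun u)
    (fun a x => bm_funl u (f a) x) (fun x b => bm_funr u x (g b)).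

Definition restrict_complex (A A' B B' : algType R)
  (f : {lrmorphism A' -> A}) (g : {lrmorphism B' -> B}) (C : complex A B) :
  complex A' B' :=
  @Complex R A' B' (fun i => restrict f g (C i))
    (fun i => restrict_hom f g (cx_d C i)) (@cx_dd R A B C).

Definition tensor_complex (A B C : algType R)
  (M : bimodule A B) (X : complex B C) : complex A C.
Proof.
exists (fun i => tensor M (X i)) (fun i => tensor_hom M (cx_d X i)) => i.
apply: (@eq_additive_tens _ _ _ _ _ _ _ _ (fun=> 0)) => [t u|t u|x y] /=.
- by rewrite !tens_homB.
- by rewrite subr0.
- by rewrite !tens_homE cx_dd; apply: (addIr (tens x 0)); rewrite -tensDr !add0r.
Defined.

End RestrictTensorComplex.

Record totalOrder (T : Type) := TotalOrder {
  to_le :> rel T;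
  to_anti : antisymmetric to_le;
  to_trans : transitive to_le;
  to_total : total to_le
}.

Definition induced_order (T : Type) (P : pred T) (le : totalOrder T) :
  totalOrder {x | P x}.
Proof.
exists (fun x y => le (val x) (val y)).
- by move=> x y h; apply: val_inj; apply: (to_anti h).
- by move=> x y z; apply: (@to_trans _ le).
- by move=> x y; apply: (@to_total _ le).
Defined.

Section CoefficientSystems.
Variables (R : comNzRingType) (A B : algType R) (S : finType).
Implicit Types (I J K : {set S}) (s t : S).

Record coefSystem := CoefSystem {
  cs_obj :> {set S} -> bimodule A B;
  cs_res : forall I J, I \subset J -> bimodHom (cs_obj I) (cs_obj J);
  cs_comp : forall I J K (IJ : I \subset J) (JK : J \subset K)
    (IK : I \subset K) x, cs_res JK (cs_res IJ x) = cs_res IK x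
}.

Variables (le : totalOrder S) (M : coefSystem).

Definition n_below I s : nat := #|[set t in I | (t != s) && le t s]|.

Definition of_card (i : int) : finType := {I : {set S} | #|I|%:Z == i}.

Definition cs_deg (i : int) : bimodule A B :=
  direct_sum (fun I : of_card i => M (val I)).

(* The restriction map [M I -> M J], extended by zero when [I] is not a subset
   of [J]. *)
Definition cs_res0 I J (x : M I) : M J :=
  if @idP (I \subset J) is ReflectT IJ then cs_res M IJ x else 0.

(* The [J]-component is the sum of the terms [(-1)^n(I,s) phi_(I|{s}, I)] over
   the [I] and the [s] not in [I] with [I |: s = J]. *)
Definition cs_diff_fun i (x : cs_deg i) : cs_deg (i + 1) :=
  mk_dsum (fun J : of_card (i + 1) =>
    \sum_(I : of_card i) \sum_(s | (s \notin val I) && (s |: val I == val J))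
      cs_res0 (val J) (dsum_coord x I) *~ (-1) ^+ n_below (val I) s).

Lemma cs_res0E I J (IJ : I \subset J) x : cs_res0 J x = cs_res M IJ x.
Proof.
rewrite /cs_res0; case: {-}_ / idP => [IJ'|//].
by rewrite (bool_irrelevance IJ' IJ).
Qed.

Lemma cs_res0D I J : zmod_morphism (@cs_res0 I J).
Proof.
move=> x y; rewrite /cs_res0; case: {-}_ / idP => [IJ|_]; first exact: raddfB.
by rewrite subr0.
Qed.

HB.instance Definition _ I J :=
  GRing.isZmodMorphism.Build (M I) (M J) (@cs_res0 I J) (@cs_res0D I J).

Lemma cs_diffB i : zmod_morphism (@cs_diff_fun i).
Proof.
move=> x y; apply: dsumP => J; rewrite dsum_coordB !mk_dsumE -sumrB.
apply: eq_bigr => I _; rewrite -sumrB; apply: eq_bigr => s _.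
by rewrite dsum_coordB raddfB /= mulrzBl.
Qed.

HB.instance Definition _ i :=
  GRing.isZmodMorphism.Build (cs_deg i) (cs_deg (i + 1)) (@cs_diff_fun i)
    (@cs_diffB i).

Definition cs_diff i : bimodHom (cs_deg i) (cs_deg (i + 1)).
Proof.
exists (@cs_diff_fun i).
- move=> a x; apply: dsumP => J; rewrite !mk_dsumE raddf_sum.
  apply: eq_bigr => I _; rewrite raddf_sum; apply: eq_bigr => s _ /=.
  rewrite raddfMz mk_dsumE /cs_res0; case: {-}_ / idP => [IJ|_] /=.
    by rewrite bm_funl.
  by rewrite raddf0.
- move=> x b; apply: dsumP => J; rewrite !mk_dsumE.
  rewrite -[RHS]/(ractr b _) raddf_sum.
  apply: eq_bigr => I _; rewrite raddf_sum; apply: eq_bigr => s _ /=.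
  rewrite raddfMz /ractr mk_dsumE /cs_res0; case: {-}_ / idP => [IJ|_] /=.
    by rewrite bm_funr.
  by rewrite raddf0.
Defined.

Lemma n_belowU I s t : s \notin I -> t \notin I -> s != t ->
  n_below (s |: I) t = (le s t + n_below I t)%N.
Proof.
move=> sI tI st; rewrite /n_below.
have -> : [set u in s |: I | (u != t) && le u t] =
    (if le s t then [set s] else set0) :|: [set u in I | (u != t) && le u t].
  apply/setP=> u; rewrite !inE; case: (eqVneq u s) => [->|us] /=.
    by rewrite st (negbTE sI); case: (le s t); rewrite ?inE ?eqxx.
  by case: (le s t); rewrite ?inE // (negbTE us).
rewrite cardsU disjoint_setI0 ?cards0 ?subn0.
  by case: (le s t); rewrite ?cards1 ?cards0.
rewrite disjoint_sym disjoints_subset; apply/subsetP=> u; rewrite !inE => /andP[uI _].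
case: (le s t); rewrite ?inE //; apply: contraNneq sI => <-; exact: uI.
Qed.

Lemma le_xor s t : s != t -> le t s = ~~ le s t.
Proof.
move=> st; case lest: (le s t); case lets: (le t s) => //=.
  by case/eqP: st; apply: (@to_anti _ le); rewrite lest lets.
by have := @to_total _ le s t; rewrite lest lets.
Qed.

Lemma sign_cancel I K :
  \sum_(s | s \notin I) \sum_(t | (t \notin s |: I) && (t |: (s |: I) == K))
    ((-1) ^+ n_below I s * (-1) ^+ n_below (s |: I) t) = 0 :> int.
Proof.
set e := LHS; suff eN : e = - e.
  by move: eN; lia.
pose P s t := [&& s \notin I, t \notin I, s != t & t |: (s |: I) == K].
have eE : e = \sum_s \sum_(t | P s t) (-1) ^+ (n_below I s + n_below I t + le s t).
  rewrite /e big_mkcond; apply: eq_bigr => s _; case: ifP => [sI|sI]; last first.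
    by rewrite big_pred0 // => t; rewrite /P sI.
  apply: eq_big => [t|t].
    by rewrite /P sI !inE negb_or (eq_sym s t); case: (t == s); case: (t \in I).
  rewrite !inE negb_or.
  case/andP=> /andP[ts tI] _; rewrite n_belowU // ?(eq_sym s) //.
  by rewrite -exprD; congr (_ ^+ _); lia.
rewrite {1}eE eE [LHS](exchange_big_dep predT) //= -sumrN; apply: eq_bigr => s _.
rewrite -sumrN; apply: eq_big => [t|t]; rewrite /P.
  by rewrite setUCA (eq_sym t s) andbCA.
case/and4P=> _ _ ts _; rewrite (le_xor ts) (addnC (n_below I t)) !exprD.
by case: (le t s); rewrite /= ?expr0 ?expr1 ?mulr1 ?mulrN1 ?opprK.
Qed.

Lemma cs_diffK i (x : cs_deg i) : cs_diff (i + 1) (cs_diff i x) = 0.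
Proof.
apply: dsumP => K; rewrite [RHS]mk_dsumE mk_dsumE.
transitivity (\sum_(I : of_card i) cs_res0 (val K) (dsum_coord x I) *~
  (\sum_(s | s \notin val I)
   \sum_(t | (t \notin s |: val I) && (t |: (s |: val I) == val K))
    ((-1) ^+ n_below (val I) s * (-1) ^+ n_below (s |: val I) t))); last first.
  by rewrite big1 // => I _; rewrite sign_cancel mulr0z.
transitivity (\sum_(I : of_card i) \sum_(J : of_card (i + 1))
  \sum_(s | (s \notin val I) && (s |: val I == val J))
  \sum_(t | (t \notin val J) && (t |: val J == val K))
   cs_res0 (val K) (dsum_coord x I) *~
     ((-1) ^+ n_below (val I) s * (-1) ^+ n_below (val J) t)).
  rewrite [RHS]exchange_big /=; apply: eq_bigr => J _.
  transitivity (\sum_(t | (t \notin val J) && (t |: val J == val K))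
    \sum_(I : of_card i) \sum_(s | (s \notin val I) && (s |: val I == val J))
     cs_res0 (val K) (dsum_coord x I) *~
       ((-1) ^+ n_below (val I) s * (-1) ^+ n_below (val J) t)).
    apply: eq_bigr => t /andP[_ /eqP eK].
    rewrite mk_dsumE raddf_sum mulrz_suml; apply: eq_bigr => I _.
    rewrite raddf_sum mulrz_suml; apply: eq_bigr => s /andP[_ /eqP eJ] /=.
    have JK := subsetUr [set t] (val J); rewrite eK in JK.
    have IJ := subsetUr [set s] (val I); rewrite eJ in IJ.
    rewrite raddfMz /= (cs_res0E IJ) (cs_res0E JK) (cs_comp _ _ (subset_trans IJ JK)).
    by rewrite (cs_res0E (subset_trans IJ JK)) mulrzA.
  rewrite exchange_big /=; apply: eq_bigr => I _.
  by rewrite exchange_big.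
apply: eq_bigr => I _; rewrite mulrz_sumr.
rewrite (exchange_big_dep (fun s => s \notin val I)) /=; last first.
  by move=> J s _ /andP[].
apply: eq_bigr => s sI; rewrite mulrz_sumr.
have cJ : #|s |: val I|%:Z == i + 1.
  by rewrite cardsU1 sI; move: (valP I) => /= /eqP; lia.
pose J : of_card (i + 1) := exist _ (s |: val I) cJ.
rewrite (big_pred1 J) // => J'; rewrite sI /= eq_sym.
by rewrite -(inj_eq val_inj).
Qed.

Definition cs_complex : complex A B := Complex cs_diffK.

End CoefficientSystems.

Section Subalgebras.
Variables (R : comNzRingType) (A : algType R) (B : subalgClosed A).

Record subalg := Subalg { subalg_val : A; subalg_valP : subalg_val \in B }.

HB.instance Definition _ := [isSub for subalg_val].
HB.instance Definition _ := [Choice of subalg by <:].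
HB.instance Definition _ := [SubChoice_isSubAlgebra of subalg by <:].

Definition subalg_incl (x : subalg) : A := val x.

Lemma subalg_incl_linear : linear subalg_incl.
Proof. by move=> a x y; rewrite /subalg_incl linearP. Qed.

Lemma subalg_incl_monoid : monoid_morphism subalg_incl.
Proof. by split=> [|x y]; rewrite /subalg_incl ?rmorph1 ?rmorphM. Qed.

HB.instance Definition _ :=
  GRing.isLinear.Build R subalg A _ subalg_incl subalg_incl_linear.
HB.instance Definition _ :=
  GRing.isMonoidMorphism.Build subalg A subalg_incl subalg_incl_monoid.

Definition subalg_inside (C : subalgClosed A) : {pred subalg} :=
  fun x => val x \in C.

Lemma subalg_inside_closed C : subalg_closed (subalg_inside C).
Proof.
split=> [|a x y|x y]; rewrite -!topredE /= /subalg_inside.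
- by rewrite rmorph1 rpred1.
- by move=> xC yC; rewrite linearP rpredD // rpredZ.
- by move=> xC yC; rewrite rmorphM rpredM.
Qed.

Definition subalg_in (C : subalgClosed A) : subalgClosed subalg :=
  HB.pack (subalg_inside C)
    (GRing.isSubalgClosed.Build R subalg _ (@subalg_inside_closed C)).

End Subalgebras.

Section FamilyComplex.
Variables (R : comNzRingType) (A : algType R) (S : finType).

Record subalgFamily := SubalgFamily {
  sf_alg :> {set S} -> subalgClosed A;
  sf_mono : forall I J : {set S}, I \subset J -> {subset sf_alg I <= sf_alg J}
}.

Variable F : subalgFamily.
Implicit Types I J K : {set S}.

Definition X_left I : bimodule A (subalg (F I)) :=
  restrict idfun (subalg_incl (B := F I)) (regular_bimodule A).
Definition X_right I : bimodule (subalg (F I)) A :=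
  restrict (subalg_incl (B := F I)) idfun (regular_bimodule A).

Definition X_obj I : bimodule A A := tensor (X_left I) (X_right I).

Definition X_tens I (x y : A) : X_obj I := tens (x : X_left I) (y : X_right I).

Definition X_res_fun I J : X_obj I -> X_obj J :=
  tens_lift (fun (x : X_left I) (y : X_right I) => X_tens J x y).

Section Restriction.
Variables (I J : {set S}) (IJ : I \subset J).

Lemma X_res_balanced :
  balanced (fun (x : X_left I) (y : X_right I) => X_tens J x y).
Proof.
split=> [x x' y|x y y'|x b y]; rewrite /X_tens.
- exact: (tensDl (x : X_left J) x' (y : X_right J)).
- exact: (tensDr (x : X_left J) (y : X_right J) y').
- exact: (tensM (x : X_left J) (Subalg (sf_mono IJ (subalg_valP b)))
    (y : X_right J)).
Qed.

Lemma X_resE x y : X_res_fun J (X_tens I x y) = X_tens J x y.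
Proof. exact: (tens_liftE X_res_balanced). Qed.

Lemma X_resB : zmod_morphism (@X_res_fun I J).
Proof. exact: tens_liftB X_res_balanced. Qed.

Definition X_res_additive : {additive X_obj I -> X_obj J} :=
  HB.pack_for {additive X_obj I -> X_obj J} (@X_res_fun I J)
    (GRing.isZmodMorphism.Build (X_obj I) (X_obj J) _ X_resB).

End Restriction.

Lemma X_lactE I (a x y : A) : lact a (X_tens I x y) = X_tens I (a * x) y.
Proof. exact: tens_lactE. Qed.

Lemma X_ractE I (x y b : A) : ract (X_tens I x y) b = X_tens I x (y * b).
Proof. exact: tens_ractE. Qed.

Lemma eq_additive_X I (V : zmodType) (f g : X_obj I -> V) :
  zmod_morphism f -> zmod_morphism g ->
  (forall x y, f (X_tens I x y) = g (X_tens I x y)) -> f =1 g.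
Proof. exact: eq_additive_tens. Qed.

Definition X_res I J (IJ : I \subset J) : bimodHom (X_obj I) (X_obj J).
Proof.
exists (X_res_additive IJ).
- move=> a; apply: eq_additive_X => [t u|t u|x y] /=.
  + by rewrite (tens_lactB a) (X_resB IJ).
  + by rewrite (X_resB IJ) (tens_lactB a).
  + rewrite (X_resE IJ) [RHS]X_lactE -(X_resE IJ).
    by congr X_res_fun; exact: X_lactE.
- move=> t b; move: t; apply: eq_additive_X => [t u|t u|x y] /=.
  + by rewrite (tens_ractB b) (X_resB IJ).
  + by rewrite (X_resB IJ) (tens_ractB b).
  + rewrite (X_resE IJ) [RHS]X_ractE -(X_resE IJ).
    by congr X_res_fun; exact: X_ractE.
Defined.

Lemma X_comp I J K (IJ : I \subset J) (JK : J \subset K) (IK : I \subset K) x :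
  X_res JK (X_res IJ x) = X_res IK x.
Proof.
move: x; apply: eq_additive_X => [t u|t u|x y] /=.
- by rewrite !X_resB.
- by rewrite X_resB.
- by rewrite !X_resE.
Qed.

Definition X_coefSystem : coefSystem A A S := CoefSystem X_comp.

Definition X_complex (le : totalOrder S) : complex A A :=
  cs_complex le X_coefSystem.

End FamilyComplex.

(* The [F I], for [I] a subset of [I0], viewed inside [F I0]. When [F] is the
   family of parabolic subalgebras of the Hecke algebra of [(W, S)], this is the
   family of parabolic subalgebras of [F I0], the Hecke algebra of [(W_I0, I0)]. *)
Definition sub_family (R : comNzRingType) (A : algType R) (S : finType)
  (F : subalgFamily A S) (I0 : {set S}) :
  subalgFamily (subalg (F I0)) {s | s \in I0}.
Proof.
exists (fun I : {set {s | s \in I0}} => subalg_in (F I0) (F [set val s | s in I])) => I J IJ x.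
exact: (sf_mono (imsetS _ IJ)).
Defined.

Section Coxeter.
Variables (W : finGroupType) (S : {set W}).

Definition gens : finType := {s : W | s \in S}.

(* [W] is generated by [S], whose elements have order 2, and is presented by the
   generators [S] and the relations [(s t)^m = 1], [m] the order of [s t] in
   [W]. *)
Record coxeter_system : Prop := CoxeterSystem {
  cox_gen : <<S>>%g = [set: W];
  cox_order2 : forall s, s \in S -> #[s]%g = 2%N;
  cox_presentation : forall (G : groupType) (f : W -> G),
    (forall s t, s \in S -> t \in S -> ((f s * f t) ^+ #[s * t] = 1)%g) ->
    exists2 phi : W -> G,
      {morph phi : x y / (x * y)%g} & {in S, phi =1 f}
}.

(* [S ^+ n] is the set of the products of [n] elements of [S]; the length has
   the value 0 outside of the submonoid generated by [S]. *)
Definition cox_length (w : W) : nat :=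
  if pselect (exists n, w \in (S ^+ n)%g) is left ex then ex_minn ex else 0%N.

Definition parabolic (I : {set gens}) : {group W} :=
  <<[set val s | s in I]>>%G.

(* That [h 1] is the unit of [H] follows from the first two axioms: see [hecke1]
   below. *)
Record is_hecke (R : comUnitRingType) (q : gens -> R) (H : algType R)
  (h : W -> H) : Prop := IsHecke {
  hecke_basis : forall x : H, exists! c : {ffun W -> R},
    x = \sum_w c w *: h w;
  hecke_mul : forall w w', cox_length (w * w')%g = (cox_length w + cox_length w')%N ->
    h w * h w' = h (w * w')%g;
  hecke_quad : forall s : gens,
    h (val s) ^+ 2 = (q s - 1) *: h (val s) + (q s)%:A
}.

Hypothesis cox : coxeter_system.

Lemma cox_exists_length w : exists n, w \in (S ^+ n)%g.
Proof.
have /gen_prodgP[n [c cS ->]] : w \in <<S>>%g by rewrite cox_gen // inE.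
exists n; elim: n c cS => [|n IHn] c cS; first by rewrite big_ord0 expg0 inE.
by rewrite big_ord_recl expgS mem_mulg // IHn.
Qed.

Lemma mem_cox_length w : w \in (S ^+ cox_length w)%g.
Proof.
rewrite /cox_length; case: pselect => [ex|]; last by case; exact: cox_exists_length.
by case: ex_minnP.
Qed.

Lemma cox_length_min w n : w \in (S ^+ n)%g -> (cox_length w <= n)%N.
Proof.
rewrite /cox_length; case: pselect => [ex|//] wn.
by case: ex_minnP => m _; apply.
Qed.

Lemma cox_parity : exists e : W -> bool,
  forall n w, w \in (S ^+ n)%g -> e w = odd n.
Proof.
pose u : {perm bool} := tperm true false.
have uu : (u * u = 1)%g by apply: tperm2.
have [s t _ _|phi phiM phiS] := cox_presentation cox (f := fun=> u).
  by rewrite uu expg1n.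
exists (fun w => odd_perm (phi w)) => n; elim: n => [|n IHn] w.
  rewrite expg0 inE => /eqP ->.
  have := phiM 1%g 1%g; rewrite mulg1 => /eqP; rewrite -{1}[phi 1%g]mulg1.
  by rewrite (inj_eq (mulgI _)) => /eqP <-; rewrite odd_perm1.
rewrite expgS => /mulsgP[s w' sS w'S ->].
by rewrite phiM odd_permM (IHn w') // phiS // odd_tperm.
Qed.

Lemma cox_lengthM s w : s \in S ->
  cox_length (s * w)%g = (cox_length w).+1 \/
  cox_length w = (cox_length (s * w)%g).+1.
Proof.
move=> sS; have [e eP] := cox_parity.
have ss : (s * s = 1)%g by rewrite -expg2 -(cox_order2 cox sS) expg_order.
have h1 : (cox_length (s * w)%g <= (cox_length w).+1)%N.
  by apply: cox_length_min; rewrite expgS mem_mulg // mem_cox_length.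
have h2 : (cox_length w <= (cox_length (s * w)%g).+1)%N.
  apply: cox_length_min; rewrite expgS -[X in X \in _]mul1g -ss -mulgA.
  by rewrite mem_mulg // mem_cox_length.
have h3 : odd (cox_length (s * w)%g) = ~~ odd (cox_length w).
  rewrite -(eP _ _ (mem_cox_length _)) -[RHS]/(odd (cox_length w).+1).
  by apply: eP; rewrite expgS mem_mulg // mem_cox_length.
have h4 : cox_length (s * w)%g != cox_length w.
  by apply: contra_eqN h3 => /eqP ->; case: odd.
lia.
Qed.

Lemma cox_length1 : cox_length 1%g = 0%N.
Proof. by apply/eqP; rewrite -leqn0; apply: cox_length_min; rewrite expg0 inE. Qed.

Lemma cox_length_gen s : s \in S -> cox_length s = 1%N.
Proof.
move=> sS; apply/eqP; rewrite eqn_leq cox_length_min ?expg1 //= lt0n.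
apply/eqP => l0; have := mem_cox_length s; rewrite l0 expg0 inE => /eqP s1.
by have := cox_order2 cox sS; rewrite s1 order1.
Qed.

Section ParabolicSubalgebra.
Implicit Types I J : {set gens}.
Variables (R : comUnitRingType) (q : gens -> R) (H : algType R) (h : W -> H).
Hypothesis q_unit : forall s, q s \is a GRing.unit.
Hypothesis hH : is_hecke q h.

Definition hecke_span (I : {set gens}) : {pred H} := fun x =>
  `[< exists c : W -> R, x = \sum_(w in parabolic I) c w *: h w >].

Lemma hecke_spanP I x : reflect
  (exists c : W -> R, x = \sum_(w in parabolic I) c w *: h w) (x \in hecke_span I).
Proof. exact: asboolP. Qed.

Lemma hecke1 : h 1%g = 1.
Proof.
have h1 w : h 1%g * h w = h w.
  by rewrite (hecke_mul hH) ?mul1g // cox_length1.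
have [c [e _]] := hecke_basis hH 1; rewrite -[LHS]mulr1 e mulr_sumr.
by apply: eq_bigr => w _; rewrite -scalerAr h1.
Qed.

Lemma hecke_span_submod I : submod_closed (hecke_span I).
Proof.
split=> [|a x y /hecke_spanP[c ->] /hecke_spanP[d ->]]; apply/hecke_spanP.
  by exists (fun=> 0); rewrite big1 // => w _; rewrite scale0r.
exists (fun w => a * c w + d w); rewrite scaler_sumr -big_split /=.
by apply: eq_bigr => w _; rewrite scalerDl scalerA.
Qed.

HB.instance Definition _ I :=
  GRing.isSubmodClosed.Build R H (hecke_span I) (hecke_span_submod I).

Lemma hecke_span_basis I w : w \in parabolic I -> h w \in hecke_span I.
Proof.
move=> wI; apply/hecke_spanP; exists (fun v => (v == w)%:R).
rewrite (bigD1 w) //= eqxx scale1r big1 ?addr0 // => v /andP[_ /negbTE->].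
by rewrite scale0r.
Qed.

Let stable I (x : H) := forall y, y \in hecke_span I -> x * y \in hecke_span I.

Lemma hecke_cases (s : gens) w :
  h (val s * w)%g = h (val s) * h w \/
  h w = h (val s) * h (val s * w)%g.
Proof.
have sS := valP s; have ss : (val s * val s = 1)%g.
  by rewrite -expg2 -(cox_order2 cox sS) expg_order.
have [l|l] := cox_lengthM w sS; [left|right].
  by rewrite (hecke_mul hH) // l (cox_length_gen sS).
by rewrite (hecke_mul hH) mulgA ss mul1g // l (cox_length_gen sS).
Qed.

Lemma hecke_stable_gen (I : {set gens}) (s : gens) : s \in I -> stable I (h (val s)).
Proof.
move=> sI _ /hecke_spanP[c ->]; rewrite mulr_sumr rpred_sum // => w wI.
have sG : val s \in parabolic I by rewrite mem_gen // imset_f.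
rewrite -scalerAr rpredZ //; have [<-|e] := hecke_cases s w.
  by rewrite hecke_span_basis // groupM.
rewrite {1}e mulrA -expr2 (hecke_quad hH) mulrDl mulr_algl -scalerAl -e.
by rewrite rpredD // rpredZ // hecke_span_basis // groupM.
Qed.

Lemma hecke_gen_inv (s : gens) :
  (q s)^-1 *: (h (val s) - (q s - 1)%:A) * h (val s) = 1.
Proof.
rewrite -scalerAl mulrBl -expr2 (hecke_quad hH) mulr_algl addrC addKr.
by rewrite scalerA mulVr ?scale1r.
Qed.

Lemma hecke_stable_basis I w : w \in parabolic I -> stable I (h w).
Proof.
move=> /gen_prodgP[n [c cI ->]] {w}.
elim: n c cI => [|n IHn] c cI y yI.
  by rewrite big_ord0 hecke1 mul1r.
rewrite big_ord_recl; set w := (\prod_(i < n) _)%g.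
have /imsetP[s sI ->] := cI ord0.
have wI : stable I (h w) by move=> z zI; apply: IHn.
have [->|e] := hecke_cases s w.
  by rewrite -mulrA; apply: hecke_stable_gen (wI _ yI).
have -> : h (val s * w)%g = (q s)^-1 *: (h (val s) - (q s - 1)%:A) * h w.
  by rewrite e mulrA hecke_gen_inv mul1r.
rewrite -!scalerAl rpredZ // mulrBl mulrBl rpredB //.
  by rewrite -mulrA; apply: hecke_stable_gen (wI _ yI).
by rewrite mulr_algl -scalerAl rpredZ // wI.
Qed.

Lemma hecke_span_subalg I : subalg_closed (hecke_span I).
Proof.
split=> [|a x y xI yI|x y /hecke_spanP[c ->] yI].
- by rewrite -hecke1 hecke_span_basis // group1.
- by rewrite rpredD // rpredZ.
- rewrite mulr_suml rpred_sum // => w wI; rewrite -scalerAl rpredZ //.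
  exact: hecke_stable_basis.
Qed.

(* [H_I]. Its closure under products is proved using the invertibility of the
   parameters. *)
Definition hecke_sub (I : {set gens}) : subalgClosed H :=
  HB.pack (hecke_span I)
    (GRing.isSubalgClosed.Build R H _ (@hecke_span_subalg I)).

Lemma hecke_sub_mono (I J : {set gens}) :
  I \subset J -> {subset hecke_sub I <= hecke_sub J}.
Proof.
move=> IJ x /hecke_spanP[c ->]; rewrite rpred_sum // => w wI.
rewrite rpredZ //; apply: hecke_span_basis.
exact: (subsetP (genS (imsetS _ IJ))) wI.
Qed.

Definition hecke_family : subalgFamily H gens := SubalgFamily hecke_sub_mono.

End ParabolicSubalgebra.
End Coxeter.

(* Main.v *)
Require Import Defs.
From HB Require Import structures.
From mathcomp Require Import all_boot all_fingroup all_algebra.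
From mathcomp Require Import zify.

Set Implicit Arguments.
Unset Strict Implicit.
Unset Printing Implicit Defensive.

Import GRing.Theory.

(** The complex X(H) is compared with H (x)_{H_I0} X(H_I0) through one chain map,
    and most of the work is an explicit partial contraction of its kernel.

    The span of the h_w with w outside W_I0 is stable under multiplication by H_I0
    on both sides, so the projection p : H -> H_I0 along it is H_I0-bilinear. Sending
    a (x)_I b to a (x)_I p(b) when I is contained in I0, and to 0 otherwise, gives a
    surjective chain map f ([proj_map]). To invert f up to homotopy it suffices to have
    bimodule maps k of degree -1 with f k = 0 such that e = 1 - (d k + k d) is nilpotent
    on ker f: then e^n is homotopic to 1, satisfies f e^n = f and kills ker f, hence
    factors as g f, and f g = 1 because f is surjective
    ([Kb_isomorphic_perturbation]).

    As a left H-module, H (x)_{H_I} H is free on the 1 (x) h_w, where w runs over the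
    elements of maximal length in their coset W_I w. If w is not in W_I0, some simple
    s lowers the length of every element of w W_I0: take a left descent of the shortest
    element of w W_I0 ([coset_descent]). Fix such an s = s(w) that depends only on the
    coset w W_I0 ([steep]). On a basis vector indexed by (J, w), k is zero unless s(w)
    belongs to J, and otherwise sends 1 (x)_J h_w to plus or minus
    1 (x)_{J - s} h_w. That k is right H_I0-linear is the point that needs care: if w is
    maximal in W_J w but w t is not, with t in I0, then w t = s' w with s' in J, so
    h_w h_t = h_s' h_w; since w t lies in w W_I0, s' differs from s(w), and h_s' can be
    moved across the tensor product over H_{J - s} ([theta_ract_max]).

    For w maximal in W_I w, the signs in d make e cancel every term of
    1 (x)_I h_w in which w remains maximal; the other terms involve maximal elements that
    are strictly longer than w. Thus e raises length on the span of the (I, w) with w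
    outside W_I0, which is ker f, and W is finite.

    The facts on Coxeter groups all follow from one cocycle. The presentation of W
    makes it act on W x bool, s sending (x, b) to (s x s, b + [x = s]); the
    boolean component is a function [inversion w x], additive in w up to conjugation of x,
    and for a reflection r it says whether l(r w) < l(w) ([len_inversion]). *)

(** * Left inversions and lengths in a Coxeter group *)

(** Convertible occurrences of the same length may differ syntactically; generalizing
    them first makes them equal atoms. *)
Ltac len_lia :=
  repeat match goal with |- context [cox_length ?S ?w] =>
    move: (cox_length S w) => ? end; lia.

Section CoxeterCombinatorics.
Local Open Scope group_scope.
Variables (W : finGroupType) (S : {set W}) (cox : coxeter_system S).
Local Notation len := (cox_length S).
Implicit Types (u v w x r s t : W) (I J : {set gens S}).

(** The action of a simple reflection s on W x bool. The boolean counts, modulo 2, how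
    often x crosses s. *)
Definition refl_fun s (p : W * bool) : W * bool := (p.1 ^ s, p.2 (+) (p.1 == s)).

Lemma refl_fun_inj s : injective (refl_fun s).
Proof.
move=> [x b] [y c] [/conjg_inj exy]; rewrite exy.
by move/(can_inj (addbK _))->.
Qed.

Definition refl_perm s : {perm W * bool} := perm (@refl_fun_inj s).

Lemma refl_permE s x b : refl_perm s (x, b) = (x ^ s, b (+) (x == s)).
Proof. exact: permE. Qed.

Lemma conjgg x : x ^ x = x.
Proof. by rewrite conjgE mulgA mulVg mul1g. Qed.

Lemma gen_sq s : s \in S -> s * s = 1.
Proof. by move=> sS; rewrite -expg2 -(cox_order2 cox sS) expg_order. Qed.

Lemma gen_inv s : s \in S -> s^-1 = s.
Proof. by move=> sS; apply/eqP; rewrite eq_invg_mul gen_sq. Qed.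

(** Since s inverts st, the times at which x meets s or t along the word stst... are
    the i with x = (st)^i s. *)
Lemma refl_perm_expg s t n x b : s \in S -> t \in S ->
  ((refl_perm s * refl_perm t) ^+ n) (x, b) =
  (x ^ ((s * t) ^+ n),
   b (+) \big[addb/false]_(0 <= i < n.*2) (x == (s * t) ^+ i * s)).
Proof.
move=> sS tS.
have inv_st j : s * (s * t) ^- j = (s * t) ^+ j * s.
  elim: j => [|j IHj]; first by rewrite expg0 invg1 mulg1 mul1g.
  rewrite expgSr invMg mulgA invMg (gen_inv sS) (gen_inv tS).
  rewrite -[LHS]mulgA -[in RHS]mulgA.
  have -> : s * (t * s * (s * t) ^- j) = (s * t) * (s * (s * t) ^- j) by rewrite !mulgA.
  by rewrite IHj !mulgA -expgS expgSr !mulgA.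
elim: n => [|n IHn].
  by rewrite !expg0 perm1 conjg1 big_geq // addbF.
rewrite expgSr permM IHn permM !refl_permE -!conjgM -expgSr.
congr (_, _); rewrite doubleS !big_nat_recr //= -!addbA; congr (_ (+) (_ (+) _)).
have eqJ g y : (x ^ g == y) = (x == y ^ g^-1) by rewrite -(inj_eq (@conjg_inj _ g) x) conjgKV.
rewrite !eqJ; congr (_ (+) _); congr (x == _).
  by rewrite conjgE invgK inv_st mulgA -expgD addnn.
rewrite conjgE invgK invMg (gen_inv sS).
have -> : (s * t) ^+ n * s * (t * (s * (s * t) ^- n)) = (s * t) ^+ n.+1 * (s * (s * t) ^- n).
  by rewrite expgSr !mulgA.
by rewrite inv_st mulgA -expgD addSn addnn.
Qed.

(** Over the full period i < 2m each element (st)^i s is met twice, so the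
    parities cancel. *)
Lemma refl_perm_braid s t : s \in S -> t \in S ->
  (refl_perm s * refl_perm t) ^+ #[s * t] = 1.
Proof.
move=> sS tS; apply/permP=> -[x b]; rewrite refl_perm_expg // expg_order conjg1 perm1.
congr (_, _); rewrite -addnn (big_cat_nat _ (leq_addr _ _)) //=.
rewrite -{2}[#[_]]add0n big_addn addKn.
under [X in _ (+) (_ (+) X)]eq_bigr do rewrite expgD expg_order mulg1.
by rewrite addbb addbF.
Qed.

(** The boolean component of the action of W, obtained from its presentation. *)
Lemma refl_cocycle : exists e : W -> W -> bool,
  (forall w w' x, e (w * w') x = e w x (+) e w' (x ^ w)) /\
  (forall s x, s \in S -> e s x = (x == s)).
Proof.
have [phi phiM phiS] := cox_presentation cox refl_perm_braid.
have phi1 : phi 1 = 1 by apply: (mulgI (phi 1)); rewrite -phiM !mulg1.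
have phiE w x b : phi w (x, b) = (x ^ w, b (+) (phi w (x, false)).2).
  have [n] := cox_exists_length cox w; elim: n w x b => [|n IHn] w x b.
    by rewrite expg0 inE => /eqP->; rewrite phi1 !perm1 conjg1 addbF.
  rewrite expgS => /mulsgP[s w' sS w'S ->].
  rewrite phiM !permM (phiS s sS) !refl_permE IHn // [in RHS]IHn //=.
  by rewrite conjgM addbA.
exists (fun w x => (phi w (x, false)).2); split=> [w w' x|s x sS].
  by rewrite phiM permM phiE [in LHS]phiE.
by rewrite (phiS s sS) refl_permE.
Qed.

Definition inversion : W -> W -> bool := sval (boolp.cid refl_cocycle).

Lemma inversionM w w' x :
  inversion (w * w') x = inversion w x (+) inversion w' (x ^ w).
Proof. exact: (svalP (boolp.cid refl_cocycle)).1. Qed.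

Lemma inversion_gen s x : s \in S -> inversion s x = (x == s).
Proof. exact: (svalP (boolp.cid refl_cocycle)).2. Qed.

Lemma inversion1 x : inversion 1 x = false.
Proof. by have := inversionM 1 1 x; rewrite mulg1 conjg1 addbb. Qed.

(** Exchange: in a word for w, r is an inversion only if it is the conjugate of a letter
    by the preceding letters, and multiplying by r deletes that letter. The set T of
    letters is kept general for use with parabolic subgroups. *)
Lemma inversion_word (T : {set W}) n w r : T \subset S -> w \in T ^+ n ->
  inversion w r -> exists2 m, m < n & r * w \in T ^+ m.
Proof.
move=> TS; elim: n w r => [|n IHn] w r.
  by rewrite expg0 inE => /eqP->; rewrite inversion1.
rewrite expgS => /mulsgP[s w' sT w'T ->]; have sS := subsetP TS s sT.
rewrite inversionM inversion_gen //; have [-> _|rs /=] := eqVneq r s.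
  by exists n => //; rewrite mulgA gen_sq // mul1g.
move=> /(IHn _ _ w'T)[m mn rw]; exists m.+1; first by [].
rewrite expgS; apply/mulsgP; exists s (r ^ s * w') => //.
by rewrite conjgE !mulgA mulgV mul1g.
Qed.

Definition reflection r := [exists s in S, r \in s ^: [set: W]].

Lemma reflectionP r : reflect (exists2 s, s \in S & exists x, r = s ^ x) (reflection r).
Proof.
apply: (iffP exists_inP) => [[s sS /imsetP[x _ ->]]|[s sS [x ->]]].
  by exists s => //; exists x.
by exists s => //; apply/imsetP; exists x.
Qed.

Lemma reflectionJ r x : reflection r -> reflection (r ^ x).
Proof.
case/reflectionP=> s sS [y ->]; apply/reflectionP; exists s => //.
by exists (y * x); rewrite conjgM.
Qed.

Lemma gen_reflection s : s \in S -> reflection s.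
Proof. by move=> sS; apply/reflectionP; exists s => //; exists 1; rewrite conjg1. Qed.

(** Writing r = x^-1 s x, the contributions of x^-1 and of x cancel and s contributes 1. *)
Lemma inversion_refl r : reflection r -> inversion r r.
Proof.
case/reflectionP=> s sS [x ->]; have := inversionM x^-1 x (s ^ x).
rewrite mulVg inversion1 {2}conjgE !inversionM conjgK [inversion s _]inversion_gen //.
have -> : s ^ s = s by rewrite conjgg.
by rewrite eqxx; case: inversion; case: inversion.
Qed.

(** One direction is the exchange property. For the other, r is an inversion of exactly
    one of w and r w, as it is an inversion of itself. *)
Lemma len_inversion r w : reflection r ->
  (len (r * w) < len w)%N = inversion w r.
Proof.
move=> rr; have lt v : inversion v r -> (len (r * v) < len v)%N.
  move=> /(inversion_word (subxx S) (mem_cox_length cox v))[m mn rv].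
  exact: leq_ltn_trans (cox_length_min rv) mn.
have rr1 : r * r = 1.
  by case/reflectionP: rr => s sS [x ->]; rewrite -conjMg gen_sq // conj1g.
apply/idP/idP => [rw|/lt//]; apply: contraLR rw => wr.
rewrite -leqNgt ltnW //; have := lt (r * w); rewrite mulgA rr1 mul1g; apply.
rewrite inversionM conjgg.
by rewrite inversion_refl // (negbTE wr).
Qed.

Lemma len_gen_inversion s w : s \in S ->
  (len (s * w) < len w)%N = inversion w s.
Proof. by move/gen_reflection/len_inversion. Qed.

Lemma len_gen_noninversion s w : s \in S -> ~~ inversion w s ->
  len (s * w) = (len w).+1.
Proof.
move=> sS; rewrite -len_gen_inversion //; case: (cox_lengthM cox w sS) => //. len_lia.
Qed.

Lemma len_gen_inversionS s w : s \in S -> inversion w s ->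
  len w = (len (s * w)).+1.
Proof.
move=> sS; rewrite -len_gen_inversion //; case: (cox_lengthM cox w sS) => //; len_lia.
Qed.

Lemma expgs_inv n w : w \in S ^+ n -> w^-1 \in S ^+ n.
Proof.
elim: n w => [|n IHn] w; first by rewrite expg0 !inE => /eqP->; rewrite invg1.
rewrite {1}expgS => /mulsgP[s w' sS w'S ->].
by rewrite expgSr invMg (gen_inv sS) mem_mulg // IHn.
Qed.

Lemma lenV w : len w^-1 = len w.
Proof.
apply/eqP; rewrite eqn_leq !cox_length_min //; last exact/expgs_inv/mem_cox_length.
by rewrite -[w in w \in _]invgK; apply/expgs_inv/mem_cox_length.
Qed.

Lemma len_eq0 w : len w = 0%N -> w = 1.
Proof. by have := mem_cox_length cox w => /[swap] ->; rewrite expg0 inE => /eqP. Qed.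

Lemma parabolic_ind I (P : W -> Prop) : P 1 ->
  (forall (s : gens S) w, s \in I -> w \in parabolic I -> P w -> P (val s * w)) ->
  forall w, w \in parabolic I -> P w.
Proof.
move=> P1 PM w /gen_prodgP[n [c cI ->]].
elim: n c cI => [|n IHn] c cI; first by rewrite big_ord0.
rewrite big_ord_recl; have /imsetP[s sI ->] := cI ord0.
apply: PM => //; last by apply: IHn.
by apply: group_prod => i _; apply: mem_gen.
Qed.

Lemma mem_parabolic I (s : gens S) : s \in I -> val s \in parabolic I.
Proof. by move=> sI; rewrite mem_gen // imset_f. Qed.

Lemma parabolicS I J : I \subset J -> parabolic I \subset parabolic J.
Proof. by move=> IJ; rewrite genS // imsetS. Qed.

(** The first letter of a shortest word in I is a descent: otherwise the exchange property
    yields a shorter word in I. *)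
Lemma parabolic_descent I w : w \in parabolic I -> w != 1 ->
  exists2 s : gens S, s \in I & inversion w (val s).
Proof.
move=> wI w1; pose T := [set val s | s in I].
have TS : T \subset S by apply/subsetP=> _ /imsetP[s _ ->]; exact: valP.
have exn : exists n, w \in T ^+ n.
  elim/parabolic_ind: w / wI {w1} => [|s w sI _ [n wn]]; first by exists 0%N; rewrite inE.
  by exists n.+1; rewrite expgS mem_mulg // imset_f.
case: (ex_minnP exn) => -[|n]; first by rewrite expg0 inE (negbTE w1).
rewrite expgS => /mulsgP[_ w' /imsetP[s sI ->] w'T ew] minw.
exists s => //; rewrite ew inversionM inversion_gen ?(valP s) // eqxx /=.
have -> : val s ^ val s = val s by rewrite conjgg.
apply/negP=> /(inversion_word TS w'T)[m mn]; rewrite -ew => /minw; len_lia.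
Qed.

Lemma mem_parabolic_gen I (s : gens S) : (val s \in parabolic I) = (s \in I).
Proof.
apply/idP/idP => [sI|]; last exact: mem_parabolic.
have s1 : val s != 1.
  by apply/eqP=> s1; have := cox_order2 cox (valP s); rewrite s1 order1.
have [t tI ts] := parabolic_descent sI s1.
move: ts; rewrite inversion_gen ?(valP s) // => /eqP /val_inj <- //.
Qed.

(** The inversions of a product of letters in I are conjugates of these letters by elements
    of W_I. *)
Lemma inversion_parabolic I w r : w \in parabolic I -> inversion w r ->
  r \in parabolic I.
Proof.
move=> wI; elim/parabolic_ind: w / wI r => [|s w sI _ IHw] r; first by rewrite inversion1.
rewrite inversionM inversion_gen ?(valP s) //.
have [-> _|_ /= /IHw] := eqVneq r; first exact: mem_parabolic.
by rewrite groupJr // mem_parabolic.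
Qed.

Definition coset_max I w := [forall u in parabolic I, len (u * w) <= len w]%N.

(** All reflections of W_I are inversions of w. By the cocycle identity, a simple s in I
    is then an inversion of exactly one of u and u w, so that l(u w) + l(u) does not
    change when u is multiplied by s. *)
Lemma coset_max_len I w u : coset_max I w -> u \in parabolic I ->
  (len (u * w) + len u = len w)%N.
Proof.
move=> /forall_inP wmax uI.
have winv r : reflection r -> r \in parabolic I -> inversion w r.
  move=> rr rI; have := len_inversion (r * w) rr; have := len_inversion w rr.
  have := wmax _ rI.
  rewrite inversionM conjgg inversion_refl //.
  have -> : r * (r * w) = w.
    by case/reflectionP: rr => s sS [x ->]; rewrite mulgA -conjMg gen_sq // conj1g mul1g.
  by case: inversion => //=; len_lia.
elim/parabolic_ind: u / uI => [|s u sI uI IHu].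
  by rewrite mul1g (cox_length1 S) addn0.
have sS := valP s.
have := winv (val s ^ u) (reflectionJ _ (gen_reflection sS)).
rewrite groupJr // => /(_ (mem_parabolic sI)) ws.
rewrite -mulgA; have := len_gen_inversion (u * w) sS; have := len_gen_inversion u sS.
rewrite inversionM ws.
have := cox_lengthM cox u sS; have := cox_lengthM cox (u * w) sS.
by move: IHu; case: inversion => /=; len_lia.
Qed.

Lemma coset_max_exists I w : exists2 u, u \in parabolic I & coset_max I (u * w).
Proof.
case: (@arg_maxnP _ 1 (mem (parabolic I)) (fun u => len (u * w)) (group1 _)) => u uI umax.
exists u => //; apply/forall_inP=> v vI; rewrite mulgA; apply: umax.
by rewrite inE groupM.
Qed.

Lemma coset_max_uniq I w u : coset_max I w -> u \in parabolic I ->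
  coset_max I (u * w) -> u = 1.
Proof.
move=> wmax uI uwmax; have := coset_max_len wmax uI.
have := coset_max_len uwmax (groupVr uI); rewrite mulKg.
by move=> e1 e2; apply: len_eq0; move: e1 e2; len_lia.
Qed.

(** If u w is the longest element of the coset and u is not 1, a descent s of u^-1 makes
    s u^-1 shorter than u^-1, hence s w longer than w. *)
Lemma coset_max_descents I w :
  reflect (forall s : gens S, s \in I -> inversion w (val s)) (coset_max I w).
Proof.
apply: (iffP idP) => [wmax s sI|winv].
  rewrite -len_gen_inversion ?(valP s) //.
  have := coset_max_len wmax (mem_parabolic sI); rewrite (cox_length_gen cox (valP s)); len_lia.
have [u uI umax] := coset_max_exists I w.
have [u1|u1] := eqVneq u 1; first by move: umax; rewrite u1 mul1g.
have uV1 : u^-1 != 1 by rewrite invg_eq1.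
have [s sI] := parabolic_descent (groupVr uI) uV1.
rewrite -len_gen_inversion ?(valP s) //.
have := winv s sI; rewrite -len_gen_inversion ?(valP s) //.
have := coset_max_len umax (groupVr uI); rewrite mulKg.
have := coset_max_len umax (groupM (mem_parabolic sI) (groupVr uI)).
by rewrite -!mulgA mulKg; len_lia.
Qed.

(** The longest element of W_I w. *)
Definition coset_top I w : W :=
  odflt 1 [pick u in parabolic I | coset_max I (u * w)] * w.

Lemma coset_topP I w : coset_max I (coset_top I w) /\
  exists2 u, u \in parabolic I & w = u * coset_top I w.
Proof.
rewrite /coset_top; case: pickP => [u /andP[uI umax]|no].
  by split=> //=; exists u^-1; rewrite ?groupV // mulKg.
by have [u uI umax] := coset_max_exists I w; have := no u; rewrite uI umax.
Qed.

Lemma coset_topE I w u : coset_max I w -> u \in parabolic I -> coset_top I (u * w) = w.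
Proof.
move=> wmax uI; have [tmax [v vI e]] := coset_topP I (u * w).
have et : coset_top I (u * w) = v^-1 * u * w.
  by rewrite -mulgA; exact: (canRL (mulKg v) (esym e)).
have uv : v^-1 * u \in parabolic I by rewrite groupM ?groupV.
by rewrite et in tmax; rewrite et (coset_max_uniq wmax uv tmax) mul1g.
Qed.

Lemma len_coset_top I w : ~~ coset_max I w -> len w < len (coset_top I w).
Proof.
have [tmax [u uI {1 2}->]] := coset_topP I w.
move: (coset_top I w) tmax => t tmax nmax; rewrite -(coset_max_len tmax uI) -addn1 leq_add2l.
by rewrite lt0n; apply: contra nmax => /eqP/len_eq0->; rewrite mul1g.
Qed.

(** The elements of I are descents of the longest element, hence inversions of an element
    of W_J, hence in W_J; so W_I is contained in W_J. *)
Lemma coset_top_parabolic I J w : coset_top I w \in parabolic J -> w \in parabolic J.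
Proof.
have [/coset_max_descents tdesc [u uI e]] := coset_topP I w => tJ.
have IJ : I \subset J.
  apply/subsetP=> s sI; rewrite -mem_parabolic_gen; exact: inversion_parabolic tJ (tdesc s sI).
by rewrite e groupM // (subsetP (parabolicS IJ)).
Qed.

Lemma mem_parabolicT w : w \in parabolic [set: gens S].
Proof.
have -> : parabolic [set: gens S] = [set: W] :> {set W}; last by rewrite inE.
rewrite -(cox_gen cox) /=; congr << _ >>; apply/setP=> s.
apply/imsetP/idP => [[t _ ->]|sS]; first exact: valP.
by exists (exist (fun x => x \in S) s sS); rewrite ?inE.
Qed.

(** A left descent s of the shortest element d of w W_I works: s^d is not in W_I,
    since s d = d s^d would be a shorter element of the coset, so it is an inversion of no
    element of W_I, and s stays an inversion of d x for all x in W_I. *)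
Lemma coset_descent I w : w \notin parabolic I ->
  exists s : gens S, forall x, x \in parabolic I -> inversion (w * x) (val s).
Proof.
move=> wI; case: (@arg_minnP _ 1 (mem (parabolic I)) (fun x => len (w * x)) (group1 _)).
move=> y yI ymin.
have y1 : w * y != 1.
  by apply: contra wI => /eqP/(canRL (mulgK y)); rewrite mul1g => ->; rewrite groupV.
have wS := mem_parabolicT (w * y).
have [s _ sy] := parabolic_descent wS y1.
exists s => x xI; have -> : w * x = w * y * (y^-1 * x) by rewrite mulgA mulgK.
rewrite inversionM sy /=; apply/negP=> /(inversion_parabolic (groupM (groupVr yI) xI)) sI.
have := ymin (y * val s ^ (w * y)); rewrite inE groupM // => /(_ isT).
have -> : w * (y * val s ^ (w * y)) = val s * (w * y) by rewrite conjgE !mulgA mulgV mul1g.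
by have := len_gen_inversion (w * y) (valP s); rewrite sy; len_lia.
Qed.

(** The cocycle identity for w t leaves s^w = t as the only way for s to stop being an
    inversion. *)
Lemma inversion_fold w s t : s \in S -> t \in S ->
  inversion w s -> ~~ inversion (w * t) s -> s * w = w * t.
Proof.
move=> sS tS ws; rewrite inversionM ws inversion_gen //= negbK => /eqP <-.
by rewrite conjgE !mulgA mulgV mul1g.
Qed.

(** A chosen simple reflection that lowers the whole coset w W_I. Its defining condition
    depends on that coset only, and it fails for W_I itself, which contains 1. *)
Definition steep I w : option (gens S) :=
  [pick s : gens S | [forall x in parabolic I, inversion (w * x) (val s)]].

Variant steep_spec I w : option (gens S) -> Prop :=
| SteepSome (s : gens S) of w \notin parabolic I &
    (forall x, x \in parabolic I -> inversion (w * x) (val s)) : steep_spec I w (Some s)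
| SteepNone of w \in parabolic I : steep_spec I w None.

Lemma steepP I w : steep_spec I w (steep I w).
Proof.
rewrite /steep; case: pickP => [s /forall_inP ws|no].
  by apply: SteepSome => //; apply/negP=> /groupVr/ws; rewrite mulgV inversion1.
apply: SteepNone; apply: contraT => /coset_descent[s ws].
by have := no s; have -> : [forall x in parabolic I, inversion (w * x) (val s)] by apply/forall_inP.
Qed.

Lemma steep_some I w (s : gens S) : steep I w = Some s ->
  w \notin parabolic I /\ forall x, x \in parabolic I -> inversion (w * x) (val s).
Proof. by case: steepP => // s' wI ws [<-]. Qed.

Lemma steepM I w x : x \in parabolic I -> steep I (w * x) = steep I w.
Proof.
move=> xI; apply: eq_pick => s; apply/forall_inP/forall_inP => ws y yI.
  by have := ws (x^-1 * y); rewrite mulgA mulgK groupM ?groupV //; apply.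
by rewrite -mulgA ws // groupM.
Qed.

End CoxeterCombinatorics.

Local Open Scope ring_scope.
Local Notation ract := Defs.ract.

(** * Bimodule maps and nilpotent perturbations of chain maps *)

Section BimodHomAlgebra.
Variables (R : comNzRingType) (A B : algType R).
Implicit Types M N P : bimodule A B.

Lemma ract0l M b : ract (0 : M) b = 0.
Proof. exact: (raddf0 (ractr b : {additive M -> M})). Qed.

Lemma lact0l M (x : M) : lact 0 x = 0.
Proof. by apply: (addIr (lact 0 x)); rewrite -lactDl !add0r. Qed.

Lemma lactN1 M (x : M) : lact (-1) x = - x.
Proof.
apply: (addIr (lact 1 x)).
by rewrite -lactDl addNr lact0l lact1 addNr.
Qed.

Lemma ractNl M (x : M) b : ract (- x) b = - ract x b.
Proof. exact: (raddfN (ractr b : {additive M -> M})). Qed.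

Definition build_hom M N (f : M -> N) (fB : zmod_morphism f)
  (fl : forall a x, f (lact a x) = lact a (f x))
  (fr : forall x b, f (ract x b) = ract (f x) b) : bimodHom M N :=
  @BimodHom _ _ _ M N (HB.pack_for {additive M -> N} f (GRing.isZmodMorphism.Build M N f fB))
    fl fr.

Definition hom_id M : bimodHom M M.
Proof. by apply: (@build_hom M M id). Defined.

Definition hom_zero M N : bimodHom M N.
Proof.
apply: (@build_hom M N (fun=> 0)) => [x y|a x|x b]; first by rewrite subr0.
  by rewrite raddf0.
by rewrite ract0l.
Defined.

Definition hom_sub M N (f g : bimodHom M N) : bimodHom M N.
Proof.
apply: (@build_hom M N (fun x => f x - g x)) => [x y|a x|x b].
- rewrite (raddfB f) (raddfB g) !opprB addrACA [RHS]addrACA. by congr (_ + _); rewrite addrC.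
- by rewrite !bm_funl raddfB.
- by rewrite !bm_funr ractDl ractNl.
Defined.

Definition hom_comp M N P (g : bimodHom N P) (f : bimodHom M N) : bimodHom M P.
Proof.
apply: (@build_hom M P (fun x => g (f x))) => [x y|a x|x b].
- by rewrite !raddfB.
- by rewrite !bm_funl.
- by rewrite !bm_funr.
Defined.

Fixpoint hom_iter M (f : bimodHom M M) n : bimodHom M M :=
  if n is m.+1 then hom_comp f (hom_iter f m) else hom_id M.

(** A bimodule map that vanishes on the kernel of a surjective one factors through it; the
    factor is computed on arbitrary preimages. *)
Lemma hom_quotient M N P (f : bimodHom M N) (g : bimodHom M P) :
  (forall y, exists x, f x = y) -> (forall x, f x = 0 -> g x = 0) ->
  {k : bimodHom N P | forall x, k (f x) = g x}.
Proof.
move=> fsurj fg; pose l y := sval (boolp.cid (fsurj y)).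
have fl y : f (l y) = y by exact: svalP (boolp.cid (fsurj y)).
have glf x : g (l (f x)) = g x.
  by apply/eqP; rewrite -subr_eq0 -raddfB; apply/eqP/fg; rewrite raddfB fl subrr.
unshelve eexists (@build_hom N P (fun y => g (l y)) _ _ _); last exact: glf.
- by move=> x y; rewrite -[x in LHS]fl -[y in LHS]fl -raddfB glf raddfB.
- by move=> a x; rewrite -[x in LHS]fl -bm_funl glf bm_funl.
- by move=> x b; rewrite -[x in LHS]fl -bm_funr glf bm_funr.
Qed.

End BimodHomAlgebra.

Section IntShift.
Variable T : int -> Type.

(** The homotopies and perturbations live in degrees written i + 1; this transports such a
    family to all degrees. *)
Definition int_shift (F : forall i, T (i + 1)) i : T i :=
  eq_rect _ T (F (i - 1)) i (subrK 1 i).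

Lemma int_shiftE F i : int_shift F (i + 1) = F i.
Proof.
rewrite /int_shift; move: (i + 1 - 1) (subrK 1 (i + 1)) => j e.
have ji : j = i by exact: addIr e.
by subst j; rewrite (eq_irrelevance e erefl).
Qed.

Lemma int_shift_ind (P : int -> Prop) : (forall i, P (i + 1)) -> forall i, P i.
Proof. by move=> Pi i; rewrite -[i](subrK 1). Qed.

End IntShift.

Section NilpotentPerturbation.
Variables (R : comNzRingType) (A B : algType R) (C D : complex A B).
Variables (f : chainMap C D) (k : forall i, bimodHom (C (i + 1)) (C i)).

(** The map 1 - (d k + k d). *)
Definition perturbation i : bimodHom (C (i + 1)) (C (i + 1)) :=
  hom_sub (hom_sub (hom_id _) (hom_comp (cx_d C i) (k i)))
    (hom_comp (k (i + 1)) (cx_d C (i + 1))).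

Lemma perturbation_comm i x :
  perturbation (i + 1) (cx_d C (i + 1) x) = cx_d C (i + 1) (perturbation i x).
Proof. by rewrite /= !raddfB !cx_dd raddf0 !subr0. Qed.

Lemma iter_perturbation_comm n i x :
  hom_iter (perturbation (i + 1)) n (cx_d C (i + 1) x) =
  cx_d C (i + 1) (hom_iter (perturbation i) n x).
Proof.
elim: n => [//|n IHn]; rewrite -perturbation_comm.
by congr (perturbation _ _).
Qed.

(** The telescoping sum of the - k e^m for m < n, where e is the perturbation. *)
Fixpoint iter_homotopy n i : bimodHom (C (i + 1)) (C i) :=
  if n is m.+1 then
    hom_sub (iter_homotopy m i) (hom_comp (k i) (hom_iter (perturbation i) m))
  else hom_zero _ _.

(** From e^(m+1) - e^m = - (d k + k d) e^m, as e commutes with d. *)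
Lemma iter_homotopyP n i x : hom_iter (perturbation i) n x - x =
  cx_d C i (iter_homotopy n i x) + iter_homotopy n (i + 1) (cx_d C (i + 1) x).
Proof.
elim: n => [|n IHn]; first by rewrite /= subrr raddf0 addr0.
set E := hom_iter (perturbation i) n x in IHn.
have -> : iter_homotopy n.+1 i x = iter_homotopy n i x - k i E by [].
have -> : hom_iter (perturbation i) n.+1 x =
  E - cx_d C i (k i E) - k (i + 1) (cx_d C (i + 1) E) by [].
have -> : iter_homotopy n.+1 (i + 1) (cx_d C (i + 1) x) =
  iter_homotopy n (i + 1) (cx_d C (i + 1) x) - k (i + 1) (cx_d C (i + 1) E).
  by rewrite -iter_perturbation_comm.
by rewrite raddfB addrACA -IHn [RHS]addrAC !addrA.
Qed.

Hypothesis f_surj : forall i y, exists x, f i x = y.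

Lemma Kb_object_surj : Kb_object C -> Kb_object D.
Proof.
case=> -[n Cn] Cfg; split; first exists n => i ni y.
  by have [x <-] := f_surj y; rewrite (Cn i ni x) raddf0.
move=> i; have [g gP] := Cfg i; exists (map (f i) g) => P [P0 PD Pl Pr] Pg y.
have [x <-] := f_surj y; apply: (gP (fun x => P (f i x))) => [|z zg]; last exact/Pg/map_f.
split=> [|z z' Pz Pz'|a z Pz|z b Pz].
- by rewrite raddf0.
- by rewrite raddfD; apply: PD.
- by rewrite bm_funl; apply: Pl.
- by rewrite bm_funr; apply: Pr.
Qed.

Hypothesis fk : forall i x, f i (k i x) = 0.
Variable n : nat.
Hypothesis nilp : forall i x, f (i + 1) x = 0 -> hom_iter (perturbation i) n x = 0.

Lemma iter_perturbation_f m i x : f (i + 1) (hom_iter (perturbation i) m x) = f (i + 1) x.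
Proof.
elim: m => [//|m IHm]; rewrite -{}IHm /=.
by rewrite !raddfB /= fk cm_comm fk raddf0 !subr0.
Qed.

(** The n-th power of the perturbation e is homotopic to the identity and factors as g f.
    As f k = 0 also gives f e = f, surjectivity of f turns f g f = f into f g = 1. *)
Theorem Kb_isomorphic_perturbation : Kb_object C -> Kb_isomorphic C D.
Proof.
move=> Cb; split=> //; first exact: Kb_object_surj.
pose g' i := hom_quotient (@f_surj (i + 1)) (@nilp i).
pose g i := int_shift (T := fun i => bimodHom (D i) (C i)) (fun i => sval (g' i)) i.
have gE i x : g (i + 1) (f (i + 1) x) = hom_iter (perturbation i) n x.
  by rewrite /g int_shiftE; exact: (svalP (g' i)).
have gd i y : g (i + 1) (cx_d D i y) = cx_d C i (g i y).
  elim/int_shift_ind: i y => i y; have [x <-] := f_surj y.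
  by rewrite -cm_comm !gE iter_perturbation_comm.
exists f, (ChainMap gd); split.
  by exists (iter_homotopy n) => i x; rewrite -iter_homotopyP /= gE.
exists (fun i => hom_zero _ _) => i y; have [x <-] := f_surj y.
by rewrite /= gE iter_perturbation_f subrr raddf0 addr0.
Qed.

End NilpotentPerturbation.

(** * The Hecke algebra and its parabolic subalgebras *)

Section HeckeAlgebra.
Variables (W : finGroupType) (S : {set W}) (cox : coxeter_system S).
Variables (R : comUnitRingType) (q : gens S -> R) (H : algType R) (h : W -> H).
Hypothesis q_unit : forall s, q s \is a GRing.unit.
Hypothesis hH : is_hecke q h.
Implicit Types (u v w x : W) (s t : gens S) (I J : {set gens S}) (a b y z : H).
Local Notation len := (cox_length S).
Local Notation inversion := (inversion cox).

Lemma hecke_ascent s w : ~~ inversion w (val s) ->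
  h (val s) * h w = h (val s * w)%g.
Proof.
move=> ws; apply: (hecke_mul hH).
by rewrite (len_gen_noninversion (valP s) ws) (cox_length_gen cox (valP s)).
Qed.

Lemma gen_mulK s w : (val s * (val s * w) = w)%g.
Proof. by rewrite mulgA (gen_sq cox (valP s)) mul1g. Qed.

(** A descent read upwards from the shorter element s w: the rule is then a product of
    basis elements and does not involve the quadratic relation. *)
Lemma hecke_descent s w : inversion w (val s) ->
  h w = h (val s) * h (val s * w)%g.
Proof.
move=> ws; rewrite (hecke_mul hH) ?gen_mulK //.
by rewrite (cox_length_gen cox (valP s)) add1n -(len_gen_inversionS (valP s) ws).
Qed.

Lemma hecke_gen_descent s w : inversion w (val s) ->
  h (val s) * h w = (q s - 1) *: h w + q s *: h (val s * w)%g.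
Proof.
move=> ws; rewrite (hecke_descent ws) mulrA -expr2 (hecke_quad hH) mulrDl.
by rewrite -scalerAl mulr_algl.
Qed.

Lemma len_gen_right w t : len (w * val t)%g = len (val t * w^-1)%g.
Proof. by rewrite -(lenV cox) invMg (gen_inv cox (valP t)). Qed.

Lemma hecke_right_ascent w t : ~~ inversion w^-1 (val t) ->
  h w * h (val t) = h (w * val t)%g.
Proof.
move=> wt; apply: (hecke_mul hH).
rewrite len_gen_right (len_gen_noninversion (valP t) wt) (lenV cox).
by rewrite (cox_length_gen cox (valP t)) addn1.
Qed.

Lemma hecke_right_descent w t : inversion w^-1 (val t) ->
  h w = h (w * val t)%g * h (val t).
Proof.
move=> wt; rewrite (hecke_mul hH) -mulgA ?(gen_sq cox (valP t)) ?mulg1 //.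
rewrite len_gen_right (cox_length_gen cox (valP t)) addn1.
by rewrite -(len_gen_inversionS (valP t) wt) (lenV cox).
Qed.

Lemma hecke_right_gen_descent w t : inversion w^-1 (val t) ->
  h w * h (val t) = (q t - 1) *: h w + q t *: h (w * val t)%g.
Proof.
move=> wt; rewrite {1}(hecke_right_descent wt) -mulrA -expr2 (hecke_quad hH) mulrDr.
by rewrite -scalerAr -(hecke_right_descent wt) mulr_algr.
Qed.

Lemma hecke_linear_ind (P : H -> Prop) :
  (forall y z, P y -> P z -> P (y + z)) -> (forall (r : R) y, P y -> P (r *: y)) ->
  (forall w, P (h w)) -> forall y, P y.
Proof.
move=> PD PZ Ph y; have [c [-> _]] := hecke_basis hH y.
by elim/big_ind: _ => [|//|w _]; [rewrite -(scale0r (h 1%g))|]; apply: PZ.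
Qed.

(** H_I is generated as an algebra by the h_s with s in I. When s w is shorter than w, the
    quadratic relation and the invertibility of q_s recover h_{s w} from h_s h_w. *)
Lemma hecke_sub_ind I (P : H -> Prop) :
  P 1 -> (forall y z, P y -> P z -> P (y + z)) ->
  (forall (r : R) y, P y -> P (r *: y)) ->
  (forall s y, s \in I -> P y -> P (h (val s) * y)) ->
  forall y, y \in hecke_span h I -> P y.
Proof.
move=> P1 PD PZ Ps y /hecke_spanP[c ->].
elim/big_ind: _ => [|//|w wI]; first by rewrite -(scale0r 1); apply: PZ.
apply: (PZ); elim/parabolic_ind: w / wI => [|s w sI _ Pw].
  by rewrite (hecke1 hH).
have [ws|ws] := boolP (inversion w (val s)); last first.
  by rewrite -hecke_ascent //; apply: Ps.
have -> : h (val s * w)%g = (q s)^-1 *: (h (val s) * h w + (1 - q s) *: h w).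
  rewrite hecke_gen_descent // addrAC -scalerDl addrA subrK subrr scale0r add0r.
  by rewrite scalerA mulVr ?scale1r.
by apply/PZ/PD/PZ => //; apply: Ps.
Qed.

Lemma hecke_inverse I u : u \in parabolic I ->
  exists2 g, g \in hecke_span h I & g * h u = 1 /\ h u * g = 1.
Proof.
elim/parabolic_ind: u / => [|s u sI uI [g gI [gu ug]]].
  by exists 1; rewrite -?(hecke1 hH) ?hecke_span_basis ?group1 // (hecke1 hH) mulr1.
have Hr := hecke_gen_inv q_unit hH s.
set hs' := (q s)^-1 *: (h (val s) - (q s - 1)%:A) in Hr.
have Hl : h (val s) * hs' = 1.
  rewrite -Hr /hs' -scalerAr -scalerAl mulrBr mulrBl.
  by rewrite mulr_algl mulr_algr.
have sI' := hecke_span_basis h (mem_parabolic sI).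
have hsI : hs' \in hecke_span h I.
  by rewrite rpredZ // rpredB // -(hecke1 hH) rpredZ // hecke_span_basis ?group1.
have mulI a b : a \in hecke_span h I -> b \in hecke_span h I -> a * b \in hecke_span h I.
  by have [_ _] := hecke_span_subalg cox q_unit hH I; apply.
have [us|us] := boolP (inversion u (val s)).
  exists (g * h (val s)); first exact: mulI.
  have -> : h (val s * u)%g = hs' * h u by rewrite (hecke_descent us) mulrA Hr mul1r.
  by split; [rewrite mulrA -(mulrA g) Hl mulr1 gu | rewrite mulrA -(mulrA hs') ug mulr1 Hr].
exists (g * hs'); first exact: mulI.
by rewrite -hecke_ascent //; split;
  [rewrite mulrA -(mulrA g) Hr mulr1 gu | rewrite mulrA -(mulrA (h _)) ug mulr1 Hl].
Qed.

Lemma hecke_inverse_exists u : exists g, g * h u = 1 /\ h u * g = 1.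
Proof.
have [|g _ gu] := @hecke_inverse [set: gens S] u; last by exists g.
by rewrite mem_parabolicT.
Qed.

(** The inverse of h_{u^-1} (not of h_u): this is the coefficient of h_w in h_{u w} when
    multiplication by u lowers the length of w by l(u). *)
Definition hecke_inv u : H := sval (boolp.cid (hecke_inverse_exists u^-1)).

Lemma hecke_invK u : hecke_inv u * h u^-1%g = 1.
Proof. exact: (svalP (boolp.cid (hecke_inverse_exists u^-1))).1. Qed.

Lemma hecke_Kinv u : h u^-1%g * hecke_inv u = 1.
Proof. exact: (svalP (boolp.cid (hecke_inverse_exists u^-1))).2. Qed.

Lemma hecke_inv_sub I u : u \in parabolic I -> hecke_inv u \in hecke_span h I.
Proof.
move=> /groupVr/hecke_inverse[g gI [_ ug]].
by rewrite -[hecke_inv u]mulr1 -ug mulrA hecke_invK mul1r.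
Qed.

Lemma hecke_inv1 : hecke_inv 1%g = 1.
Proof. by have := hecke_invK 1; rewrite invg1 (hecke1 hH) mulr1. Qed.

Lemma hecke_inv_descent s u : inversion u (val s) ->
  hecke_inv (val s * u) = h (val s) * hecke_inv u.
Proof.
move=> us; have := hecke_Kinv u.
have e : h u^-1%g = h (val s * u)^-1%g * h (val s).
  have eu : (u^-1 = (val s * u)^-1 * val s)%g by rewrite invMg mulgKV.
  rewrite [in LHS]eu (hecke_mul hH) // -eu !(lenV cox) (cox_length_gen cox (valP s)) addn1.
  exact: (len_gen_inversionS (valP s) us).
rewrite e -mulrA => e1.
by rewrite -[LHS]mulr1 -e1 mulrA hecke_invK mul1r.
Qed.

(** For w of maximal length in W_I w the lengths of u^-1 and u w add up to that of w, so
    h_{u^-1} h_{u w} = h_w. This is what makes H free over H_I on the h_w with w maximal in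
    its coset. *)
Lemma coset_max_hecke I w u : coset_max I w -> u \in parabolic I ->
  h (u * w)%g = hecke_inv u * h w.
Proof.
move=> wmax uI; have e : h u^-1%g * h (u * w)%g = h w.
  rewrite (hecke_mul hH) mulKg // (lenV cox) addnC.
  by rewrite (coset_max_len cox wmax uI).
by rewrite -e mulrA hecke_invK mul1r.
Qed.

Definition hecke_coord y : W -> R := sval (boolp.cid (hecke_basis hH y)).

Lemma hecke_coordE y : y = \sum_w hecke_coord y w *: h w.
Proof. exact: (svalP (boolp.cid (hecke_basis hH y))).1. Qed.

Lemma hecke_coord_uniq y (c : W -> R) : y = \sum_w c w *: h w -> hecke_coord y =1 c.
Proof.
move=> e w; rewrite /hecke_coord; case: boolp.cid => d [_ /= ud].
rewrite (ud (finfun c)) ?ffunE // e.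
by apply: eq_bigr => v _; rewrite ffunE.
Qed.

Lemma hecke_coordD y z w : hecke_coord (y + z) w = hecke_coord y w + hecke_coord z w.
Proof.
move: w; apply: hecke_coord_uniq; rewrite {1}[y]hecke_coordE {1}[z]hecke_coordE -big_split.
by apply: eq_bigr => v _; rewrite scalerDl.
Qed.

Lemma hecke_coordZ r y w : hecke_coord (r *: y) w = r * hecke_coord y w.
Proof.
move: w; apply: hecke_coord_uniq; rewrite {1}[y]hecke_coordE scaler_sumr.
by apply: eq_bigr => v _; rewrite scalerA.
Qed.

Lemma hecke_coord_basis v w : hecke_coord (h v) w = (w == v)%:R.
Proof.
move: w; apply: hecke_coord_uniq; rewrite (bigD1 v) //= eqxx scale1r big1 ?addr0 //.
by move=> w /negbTE->; rewrite scale0r.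
Qed.

Section LinearExtension.
Variables (B : algType R) (V : bimodule H B) (phi : W -> V).

(** The R-linear extension of a map defined on the basis, the scalars acting through the
    left action of H. *)
Definition linear_ext y : V := \sum_w lact (hecke_coord y w)%:A (phi w).

Lemma linear_extD : {morph linear_ext : y z / y + z}.
Proof.
move=> y z; rewrite -big_split; apply: eq_bigr => w _ /=.
by rewrite hecke_coordD scalerDl lactDl.
Qed.

Lemma linear_extZ r y : linear_ext (r *: y) = lact r%:A (linear_ext y).
Proof.
rewrite raddf_sum; apply: eq_bigr => w _ /=.
by rewrite hecke_coordZ -lactM -scalerAl mul1r scalerA.
Qed.

Lemma linear_ext_basis w : linear_ext (h w) = phi w.
Proof.
rewrite /linear_ext (bigD1 w) //= hecke_coord_basis eqxx scale1r lact1 big1 ?addr0 //.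
by move=> v /negbTE vw; rewrite hecke_coord_basis vw scale0r lact0l.
Qed.

End LinearExtension.

Section Projection.
Variable I : {set gens S}.

Definition parabolic_proj y : H := \sum_(w in parabolic I) hecke_coord y w *: h w.

Lemma parabolic_proj_in y : parabolic_proj y \in hecke_span h I.
Proof. by rewrite rpred_sum // => w wI; rewrite rpredZ // hecke_span_basis. Qed.

Lemma parabolic_projD : {morph parabolic_proj : y z / y + z}.
Proof.
by move=> y z; rewrite -big_split; apply: eq_bigr => w _; rewrite hecke_coordD scalerDl.
Qed.

Lemma parabolic_projZ r y : parabolic_proj (r *: y) = r *: parabolic_proj y.
Proof.
by rewrite scaler_sumr; apply: eq_bigr => w _; rewrite hecke_coordZ scalerA.
Qed.

Lemma parabolic_proj_basis w :
  parabolic_proj (h w) = if w \in parabolic I then h w else 0.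
Proof.
rewrite /parabolic_proj big_mkcond (bigD1 w) //= hecke_coord_basis eqxx scale1r.
rewrite big1 ?addr0 // => v /negbTE vw.
by rewrite hecke_coord_basis vw scale0r if_same.
Qed.

Lemma parabolic_projMl b y : b \in hecke_span h I ->
  parabolic_proj (b * y) = b * parabolic_proj y.
Proof.
move=> bI; elim/hecke_sub_ind: b / bI y => [|b b' IHb IHb'|r b IHb|s b sI IHb] y.
- by rewrite !mul1r.
- by rewrite !mulrDl parabolic_projD IHb IHb'.
- by rewrite -!scalerAl parabolic_projZ IHb.
rewrite -!mulrA -IHb; elim/hecke_linear_ind: (b * y) => [z z' IHz IHz'|r z IHz|w].
- by rewrite mulrDr !parabolic_projD mulrDr IHz IHz'.
- by rewrite -scalerAr !parabolic_projZ IHz scalerAr.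
have sw : (val s * w \in parabolic I)%g = (w \in parabolic I).
  by rewrite groupMl // mem_parabolic.
have [ws|ws] := boolP (inversion w (val s)); last first.
  rewrite hecke_ascent // !parabolic_proj_basis sw.
  by case: ifP => _; rewrite ?mulr0 // hecke_ascent.
rewrite hecke_gen_descent // parabolic_projD !parabolic_projZ !parabolic_proj_basis sw.
by case: ifP => _; rewrite ?mulr0 ?scaler0 ?addr0 // hecke_gen_descent.
Qed.

Lemma parabolic_projMr b y : b \in hecke_span h I ->
  parabolic_proj (y * b) = parabolic_proj y * b.
Proof.
move=> bI; elim/hecke_sub_ind: b / bI y => [|b b' IHb IHb'|r b IHb|s b sI IHb] y.
- by rewrite !mulr1.
- by rewrite !mulrDr parabolic_projD IHb IHb'.
- by rewrite -!scalerAr parabolic_projZ IHb.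
rewrite !mulrA IHb; congr (_ * b); elim/hecke_linear_ind: y => [z z' IHz IHz'|r z IHz|w].
- by rewrite mulrDl !parabolic_projD mulrDl IHz IHz'.
- by rewrite -scalerAl !parabolic_projZ IHz scalerAl.
have sw : (w * val s \in parabolic I)%g = (w \in parabolic I).
  by rewrite groupMr // mem_parabolic.
have [ws|ws] := boolP (inversion w^-1 (val s)); last first.
  rewrite hecke_right_ascent // !parabolic_proj_basis sw.
  by case: ifP => _; rewrite ?mul0r // hecke_right_ascent.
rewrite hecke_right_gen_descent // parabolic_projD !parabolic_projZ !parabolic_proj_basis sw.
by case: ifP => _; rewrite ?mul0r ?scaler0 ?addr0 // hecke_right_gen_descent.
Qed.

End Projection.

End HeckeAlgebra.

(** * Complexes of coefficient systems, cell by cell *)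

Lemma zmod_morphMz (U V : zmodType) (f : U -> V) x n :
  zmod_morphism f -> f (x *~ n) = f x *~ n.
Proof.
move=> fB; pose f' : {additive U -> V} := HB.pack f (GRing.isZmodMorphism.Build U V f fB).
exact: (raddfMz f').
Qed.

Lemma zmod_morph_sum (U V : zmodType) (f : U -> V) (I : Type) (r : seq I) (P : pred I) G :
  zmod_morphism f -> f (\sum_(i <- r | P i) G i) = \sum_(i <- r | P i) f (G i).
Proof.
by move=> fB; apply: (big_morph f); [exact: zmod_morphD | exact: zmod_morph0].
Qed.

Lemma zmod_morph_comp (U V T : zmodType) (f : V -> T) (g : U -> V) :
  zmod_morphism f -> zmod_morphism g -> zmod_morphism (fun x => f (g x)).
Proof. by move=> fB gB x y; rewrite gB fB. Qed.

Section Cells.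
Variables (R : comNzRingType) (A B : algType R) (S : finType).
Variables (M : coefSystem A B S) (le : totalOrder S).
Implicit Types (I J : {set S}) (i : int) (u v : forall J, M J).
Local Notation X i := (cs_deg M i).

Definition dcoord i (J : of_card S i) (x : X i) : M (val J) := dsum_coord x J.

Lemma dcoordP i (x y : X i) : (forall J : of_card S i, dcoord J x = dcoord J y) -> x = y.
Proof. exact: dsumP. Qed.

Lemma dcoordD i (J : of_card S i) (x y : X i) : dcoord J (x + y) = dcoord J x + dcoord J y.
Proof. exact: (@dsum_coordD R A B _ (fun J : of_card S i => M (val J)) x y J). Qed.

Lemma dcoordB i (J : of_card S i) : zmod_morphism (@dcoord i J).
Proof. by move=> x y; exact: (@dsum_coordB R A B _ (fun J : of_card S i => M (val J)) x y J). Qed.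

Lemma dcoord0 i (J : of_card S i) : dcoord J 0 = 0.
Proof. exact: zmod_morph0 (@dcoordB i J). Qed.

Lemma dcoord_sum i (J : of_card S i) (T : Type) (r : seq T) (P : pred T) (G : T -> X i) :
  dcoord J (\sum_(t <- r | P t) G t) = \sum_(t <- r | P t) dcoord J (G t).
Proof. exact: zmod_morph_sum (@dcoordB i J). Qed.

Lemma dcoordMz i (J : of_card S i) (x : X i) n : dcoord J (x *~ n) = dcoord J x *~ n.
Proof. exact: zmod_morphMz (@dcoordB i J). Qed.

Lemma coord_lact i (J : of_card S i) (x : X i) c : dcoord J (lact c x) = lact c (dcoord J x).
Proof. by rewrite /dcoord mk_dsumE. Qed.

Lemma coord_ract i (J : of_card S i) (x : X i) c : dcoord J (ract x c) = ract (dcoord J x) c.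
Proof. by rewrite /dcoord mk_dsumE. Qed.

(** Zero when I does not have cardinality i. Taking a family u indexed by all subsets, and
    testing equality of subsets, avoids transports along equalities of subsets and of
    degrees. *)
Definition cell i I u : X i :=
  mk_dsum (M := fun J : of_card S i => M (val J))
    (fun J : of_card S i => if val J == I then u (val J) else 0).

Lemma cell_coord i I u (J : of_card S i) :
  dcoord J (cell i I u) = if val J == I then u (val J) else 0.
Proof. by rewrite /dcoord mk_dsumE. Qed.

Lemma eq_cell i I u v : u I = v I -> cell i I u = cell i I v.
Proof. by move=> uv; apply: dcoordP => J; rewrite !cell_coord; case: eqP => // ->. Qed.

Lemma cellD i I u v : cell i I (fun J => u J + v J) = cell i I u + cell i I v.
Proof.
by apply: dcoordP => J; rewrite dcoordD !cell_coord; case: eqP => _ //; rewrite addr0.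
Qed.

Lemma cell_lact i I u c : lact c (cell i I u) = cell i I (fun J => lact c (u J)).
Proof.
apply: dcoordP => J; rewrite coord_lact !cell_coord; case: eqP => _ //.
exact: raddf0.
Qed.

Lemma cell_ract i I u c : ract (cell i I u) c = cell i I (fun J => ract (u J) c).
Proof.
apply: dcoordP => J; rewrite coord_ract !cell_coord; case: eqP => _ //.
exact: ract0l.
Qed.

(** Generators u t J of the values M J give generators of the complex in each degree. *)
Lemma cell_ind i (T : Type) (u : T -> forall J, M J) :
  (forall J (P : M J -> Prop), P 0 -> (forall x y, P x -> P y -> P (x - y)) ->
     (forall t, P (u t J)) -> forall x, P x) ->
  forall (P : X i -> Prop), P 0 -> (forall x y, P x -> P y -> P (x - y)) ->
  (forall I t, #|I|%:Z = i -> P (cell i I (u t))) -> forall x, P x.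
Proof.
move=> Mu P P0 PB Pc x.
have PD y z : P y -> P z -> P (y + z).
  by move=> Py Pz; rewrite -[z]opprK; apply: (PB) => //; rewrite -[- z]add0r; apply: PB.
have lift (J : of_card S i) (y : M (val J)) :
    exists z, [/\ P z, dcoord J z = y & forall K, K != J -> dcoord K z = 0].
  elim/(Mu (val J)): y => [|y y' [z [Pz <- z0]] [z' [Pz' <- z0']]|t].
  - by exists 0; split=> // *; rewrite dcoord0.
  - exists (z - z'); split; [exact: PB | by rewrite dcoordB|] => K KJ.
    by rewrite dcoordB z0 // z0' // subr0.
  - exists (cell i (val J) (u t)); split; first by apply/Pc/eqP; exact: (valP J).
      by rewrite cell_coord eqxx.
    by move=> K KJ; rewrite cell_coord (inj_eq val_inj) (negbTE KJ).
pose z (J : of_card S i) := sval (boolp.cid (lift J (dcoord J x))).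
have zP (J : of_card S i) : [/\ P (z J), dcoord J (z J) = dcoord J x &
  forall K, K != J -> dcoord K (z J) = 0] by exact: (svalP (boolp.cid (lift J _))).
have -> : x = \sum_(J : of_card S i) z J.
  apply: dcoordP => J; rewrite dcoord_sum (bigD1 J) //= big1 ?addr0.
    by have [_ ->] := zP J.
  by move=> K KJ; have [_ _ ->] := zP K; rewrite // eq_sym.
by elim/big_ind: _ => // J _; have [] := zP J.
Qed.

Section CellIndex.
Variables (i : int) (I : {set S}) (Ii : #|I|%:Z = i).

Let Ii' : (fun I : {set S} => #|I|%:Z == i) I. Proof. exact/eqP. Qed.

Definition card_index : of_card S i := exist _ I Ii'.

Lemma sum_cell (V : zmodType) (G : forall J : of_card S i, M (val J) -> V) u :
  (forall J : of_card S i, zmod_morphism (G J)) ->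
  \sum_(J : of_card S i) G J (dcoord J (cell i I u)) = G card_index (u I).
Proof.
move=> GB; rewrite (bigD1 card_index) //= cell_coord eqxx big1 ?addr0 // => J JI.
have /negbTE nJI : val J != I by apply: contra JI => /eqP eJ; apply/eqP/val_inj.
by rewrite cell_coord nJI zmod_morph0.
Qed.

End CellIndex.

Lemma cs_diff_coord i (x : X i) (J : of_card S (i + 1)) :
  dcoord J (cs_diff le M i x) =
  \sum_(I : of_card S i) \sum_(s | (s \notin val I) && (s |: val I == val J))
      cs_res0 (val J) (dcoord I x) *~ (-1) ^+ n_below le (val I) s.
Proof. by rewrite /dcoord mk_dsumE. Qed.

Lemma cell_diff i I u : #|I|%:Z = i ->
  (forall J (IJ : I \subset J), cs_res M IJ (u I) = u J) ->
  cs_diff le M i (cell i I u) =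
  \sum_(s | s \notin I) cell (i + 1) (s |: I) u *~ (-1) ^+ n_below le I s.
Proof.
move=> Ii ures; apply: dcoordP => J; rewrite cs_diff_coord dcoord_sum.
rewrite (sum_cell Ii (G := fun (I : of_card S i) x =>
  \sum_(s | (s \notin val I) && (s |: val I == val J))
      cs_res0 (val J) x *~ (-1) ^+ n_below le (val I) s)); last first.
  move=> K x y; rewrite -sumrB; apply: eq_bigr => s _.
  by rewrite cs_res0D mulrzBl.
rewrite big_mkcondr; apply: eq_bigr => s sI; rewrite dcoordMz cell_coord.
rewrite /= eq_sym; case: eqP => [eJ|_]; last by rewrite mul0rz.
have IJ : I \subset val J by have := subsetUr [set s] I; rewrite -eJ.
by rewrite -(ures _ IJ) -(cs_res0E IJ).
Qed.

Variables (B' : algType R) (g : {lrmorphism B' -> B}).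
Variable kappa : forall J I, S -> M J -> M I.
Arguments kappa : clear implicits.
Hypothesis kappaB : forall I s, zmod_morphism (kappa (s |: I) I s).
Hypothesis kappal : forall I s c x,
  kappa (s |: I) I s (lact c x) = lact c (kappa (s |: I) I s x).
Hypothesis kappar : forall I s x (c : B'),
  kappa (s |: I) I s (ract x (g c)) = ract (kappa (s |: I) I s x) (g c).

(** The mirror image of the differential: kappa removes an element s from a subset, with
    the sign by which the differential adds it. *)
Definition contraction_fun i (x : X (i + 1)) : X i :=
  mk_dsum (M := fun J : of_card S i => M (val J)) (fun I : of_card S i =>
    \sum_(J : of_card S (i + 1)) \sum_(s | (s \notin val I) && (s |: val I == val J))
      kappa (val J) (val I) s (dcoord J x) *~ (-1) ^+ n_below le (val I) s).

Lemma contraction_coord i (x : X (i + 1)) (I : of_card S i) :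
  dcoord I (contraction_fun x) =
    \sum_(J : of_card S (i + 1)) \sum_(s | (s \notin val I) && (s |: val I == val J))
      kappa (val J) (val I) s (dcoord J x) *~ (-1) ^+ n_below le (val I) s.
Proof. by rewrite /dcoord mk_dsumE. Qed.

Lemma kappaB' I J s : s |: I == J -> zmod_morphism (kappa J I s).
Proof. by move=> /eqP<-; exact: kappaB. Qed.

Lemma kappal' I J s c x : s |: I == J ->
  kappa J I s (lact c x) = lact c (kappa J I s x).
Proof. by move=> /eqP eJ; subst J; exact: kappal. Qed.

Lemma kappar' I J s x (c : B') : s |: I == J ->
  kappa J I s (ract x (g c)) = ract (kappa J I s x) (g c).
Proof. by move=> /eqP eJ; subst J; exact: kappar. Qed.

Lemma contractionB i : zmod_morphism (@contraction_fun i).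
Proof.
move=> x y; apply: dcoordP => I; rewrite dcoordB !contraction_coord.
rewrite -sumrB; apply: eq_bigr => J _; rewrite -sumrB; apply: eq_bigr => s /andP[_ sJ].
by rewrite dcoordB (kappaB' sJ) mulrzBl.
Qed.

Lemma contractionl i c (x : X (i + 1)) : contraction_fun (lact c x) = lact c (contraction_fun x).
Proof.
apply: dcoordP => I; rewrite coord_lact !contraction_coord raddf_sum.
apply: eq_bigr => J _; rewrite raddf_sum; apply: eq_bigr => s /andP[_ sJ].
by rewrite coord_lact /= raddfMz kappal'.
Qed.

Lemma contractionr i (x : X (i + 1)) (c : B') :
  contraction_fun (ract x (g c)) = ract (contraction_fun x) (g c).
Proof.
apply: dcoordP => I; rewrite coord_ract !contraction_coord.
rewrite (zmod_morph_sum _ _ _ (@ractBl _ _ _ (M (val I)) (g c))); apply: eq_bigr => J _.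
rewrite (zmod_morph_sum _ _ _ (@ractBl _ _ _ (M (val I)) (g c))).
apply: eq_bigr => s /andP[_ sJ].
rewrite coord_ract /= (zmod_morphMz _ _ (@ractBl _ _ _ (M (val I)) (g c))).
by rewrite kappar'.
Qed.

Definition contraction i :
    bimodHom (restrict idfun g (X (i + 1))) (restrict idfun g (X i)) :=
  @build_hom _ _ _ (restrict idfun g (X (i + 1))) (restrict idfun g (X i))
    (@contraction_fun i) (@contractionB i) (@contractionl i) (@contractionr i).

(** The situation of interest: kappa removes at most one element o from J. *)
Lemma cell_contraction i J u v (o : option S) : #|J|%:Z = i + 1 ->
  (forall I s, s |: I = J -> kappa J I s (u J) = if o == Some s then v I else 0) ->
  contraction_fun (cell (i + 1) J u) =
  if o is Some s then
    if s \in J then cell i (J :\ s) v *~ (-1) ^+ n_below le (J :\ s) s else 0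
  else 0.
Proof.
move=> Ji uv; apply: dcoordP => I; rewrite contraction_coord.
rewrite (sum_cell Ji (G := fun (J : of_card S (i + 1)) x =>
  \sum_(s | (s \notin val I) && (s |: val I == val J))
      kappa (val J) (val I) s x *~ (-1) ^+ n_below le (val I) s)); last first.
  move=> K x y; rewrite -sumrB; apply: eq_bigr => s /andP[_ sJ].
  by rewrite (kappaB' sJ) mulrzBl.
rewrite /=; case: o uv => [s|] uv; last first.
  rewrite dcoord0 big1 // => s /andP[_ /eqP eJ].
  by rewrite uv // mul0rz.
have e t : t |: val I == J -> kappa J (val I) t (u J) = if s == t then v (val I) else 0.
  by move=> /eqP/uv.
case: ifP => sJ; last first.
  rewrite dcoord0 big1 // => t /andP[_ tJ]; rewrite (e t tJ).
  case: eqP => [est|_]; last by rewrite mul0rz.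
  by move: sJ; rewrite est -(eqP tJ) setU11.
rewrite dcoordMz cell_coord; case: eqP => [eI|neI]; last first.
  rewrite big1 ?mul0rz // => t /andP[tI tJ]; rewrite (e t tJ).
  case: eqP => [est|_]; last by rewrite mul0rz.
  by case: neI; rewrite -(eqP tJ) est setU1K.
rewrite (big_pred1 s).
  by rewrite -[sval I]/(val I) e ?eqxx eI ?setD1K.
move=> t; rewrite /= -[sval I]/(val I) eI; apply/andP/eqP => [[tI /eqP tJ]|->];
  last by rewrite setD11 setD1K.
by have := sJ; rewrite -tJ in_setU1 setD11 orbF => /eqP->.
Qed.

End Cells.

(** * The complex of a family of subalgebras *)

Section FamilyCells.
Variables (R : comNzRingType) (A : algType R) (S : finType) (F : subalgFamily A S).
Implicit Types (I J : {set S}) (i : int) (a b c : A).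
Local Notation X i := (cs_deg (X_coefSystem F) i).

Lemma X_tensDl I a a' b : X_tens F I (a + a') b = X_tens F I a b + X_tens F I a' b.
Proof. exact: (tensDl (a : X_left F I) a' (b : X_right F I)). Qed.

Lemma X_tensDr I a b b' : X_tens F I a (b + b') = X_tens F I a b + X_tens F I a b'.
Proof. exact: (tensDr (a : X_left F I) (b : X_right F I) b'). Qed.

Lemma X_tensM I a b c : b \in F I -> X_tens F I (a * b) c = X_tens F I a (b * c).
Proof. by move=> bI; exact: (tensM (a : X_left F I) (Subalg bI) (c : X_right F I)). Qed.

Definition X_cell i I a b : X i :=
  cell (M := X_coefSystem F) i I (fun J => X_tens F J a b).

Lemma X_cellDl i I a a' b : X_cell i I (a + a') b = X_cell i I a b + X_cell i I a' b.
Proof.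
rewrite /X_cell -(cellD (M := X_coefSystem F)); apply: eq_cell; exact: X_tensDl.
Qed.

Lemma X_cellDr i I a b b' : X_cell i I a (b + b') = X_cell i I a b + X_cell i I a b'.
Proof.
rewrite /X_cell -(cellD (M := X_coefSystem F)); apply: eq_cell; exact: X_tensDr.
Qed.

Lemma X_cellr0 i I a : X_cell i I a 0 = 0.
Proof. by apply: (addrI (X_cell i I a 0)); rewrite -X_cellDr !addr0. Qed.

Lemma X_cellM i I a b c : b \in F I -> X_cell i I (a * b) c = X_cell i I a (b * c).
Proof. by move=> bI; apply: eq_cell; exact: X_tensM. Qed.

Lemma X_cell_lact i I a b c : lact c (X_cell i I a b) = X_cell i I (c * a) b.
Proof. by rewrite /X_cell cell_lact; apply: eq_cell; exact: X_lactE. Qed.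

Lemma X_cell_ract i I a b c : ract (X_cell i I a b) c = X_cell i I a (b * c).
Proof. by rewrite /X_cell cell_ract; apply: eq_cell; exact: X_ractE. Qed.

Lemma X_cell_diff (le : totalOrder S) i I a b : #|I|%:Z = i ->
  cs_diff le (X_coefSystem F) i (X_cell i I a b) =
  \sum_(s | s \notin I) X_cell (i + 1) (s |: I) a b *~ (-1) ^+ n_below le I s.
Proof. by move=> Ii; apply: cell_diff => // J IJ; exact: (X_resE F IJ a b). Qed.

Lemma X_cell_ind i (P : X i -> Prop) : P 0 -> (forall x y, P x -> P y -> P (x - y)) ->
  (forall I a b, #|I|%:Z = i -> P (X_cell i I a b)) -> forall x, P x.
Proof.
move=> P0 PB Pc; pose u (p : A * A) J := X_tens F J p.1 p.2.
have ugen J (Q : X_coefSystem F J -> Prop) : Q 0 -> (forall x y, Q x -> Q y -> Q (x - y)) ->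
    (forall p, Q (u p J)) -> forall x, Q x.
  by move=> Q0 QB Qu; apply: tens_ind => // a b; exact: (Qu (a, b)).
by apply: (cell_ind ugen P0 PB) => I [a b] Ii; exact: Pc.
Qed.

Lemma additive_X_cell i (V : zmodType) (f g : X i -> V) :
  zmod_morphism f -> zmod_morphism g ->
  (forall I a b, #|I|%:Z = i -> f (X_cell i I a b) = g (X_cell i I a b)) -> f =1 g.
Proof.
move=> fB gB e; apply: X_cell_ind => [|x y ex ey|//]; first by rewrite !zmod_morph0.
by rewrite fB gB ex ey.
Qed.

End FamilyCells.

(** * Projection onto the complex of one subalgebra *)

Lemma additive_zmod_morphism (U V : zmodType) (f : U -> V) :
  {morph f : x y / x + y} -> zmod_morphism f.
Proof. by move=> fD x y; apply: (addIr (f y)); rewrite -fD !subrK. Qed.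

Lemma zmod_morph_bigsum (U V : zmodType) (T : Type) (r : seq T) (f : T -> U -> V) :
  (forall t, zmod_morphism (f t)) -> zmod_morphism (fun x => \sum_(t <- r) f t x).
Proof. by move=> fB x y; rewrite -sumrB; apply: eq_bigr => t _; apply: fB. Qed.

Lemma sum_subtype (V : zmodType) (S : finType) (T : {set S}) (P : pred S) (G : S -> V) :
  \sum_(s | P s) (if s \in T then G s else 0) =
  \sum_(s : {s | s \in T} | P (val s)) G (val s).
Proof.
rewrite -big_mkcondr (@reindex_omap _ _ _ _ {s | s \in T} val insub) /= => [|s /andP[_ sT]];
  last by rewrite insubT.
by apply: eq_bigl => s; rewrite valK eqxx andbT (valP s) andbT.
Qed.

Section TensorLemmas.
Variables (R : comNzRingType) (A B C : algType R) (M : bimodule A B) (N : bimodule B C).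

Lemma tensor_lactE a (x : M) (y : N) :
  lact a (tens x y : tensor M N) = tens (lact a x) y.
Proof. exact: tens_lactE. Qed.

Lemma tensor_ractE c (x : M) (y : N) :
  ract (tens x y : tensor M N) c = tens x (ract y c).
Proof. exact: tens_ractE. Qed.

Lemma tensBr (x : M) : zmod_morphism (tens x : N -> tensor M N).
Proof. exact: additive_zmod_morphism (tensDr x). Qed.

End TensorLemmas.

Section Projection.
Variables (R : comNzRingType) (A : algType R) (S : finType) (F : subalgFamily A S).
Variables (le : totalOrder S) (I0 : {set S}).
Implicit Types (I J : {set S}) (i : int) (a b : A).
Local Notation A0 := (subalg (F I0)).
Local Notation F0 := (sub_family F I0).
Local Notation S0 := {s | s \in I0}.
Local Notation le0 := (induced_order (mem I0) le).
Local Notation incl := (subalg_incl (B := F I0)).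
Local Notation X := (X_complex F le).
Local Notation X0 := (X_complex F0 le0).
Local Notation M := (restrict idfun incl (regular_bimodule A)).
Local Notation XR := (restrict_complex idfun incl X).
Local Notation Y := (tensor_complex M X0).

Variable p : A -> A0.
Hypothesis pB : zmod_morphism p.
Hypothesis pl : forall (b : A0) a, p (incl b * a) = b * p a.
Hypothesis pr : forall a (b : A0), p (a * incl b) = p a * b.
Hypothesis pK : forall b : A0, p (incl b) = b.

Definition trace I : {set S0} := [set s | val s \in I].

Lemma traceK I : I \subset I0 -> val @: trace I = I.
Proof.
move=> II0; apply/setP=> s; apply/imsetP/idP => [[t]|sI]; first by rewrite inE => tI ->.
by exists (exist (fun s => s \in I0) s (subsetP II0 s sI)); rewrite ?inE.
Qed.

Lemma imsetK_trace (K : {set S0}) : trace (val @: K) = K.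
Proof. by apply/setP=> s; rewrite inE (mem_imset _ _ val_inj). Qed.

Lemma imset_sub (K : {set S0}) : val @: K \subset I0.
Proof. by apply/subsetP=> _ /imsetP[s _ ->]; exact: valP. Qed.

Lemma card_trace I : I \subset I0 -> #|trace I| = #|I|.
Proof. by move=> II0; rewrite -[in RHS](traceK II0) card_imset //; exact: val_inj. Qed.

Lemma n_below_trace I (s : S0) : I \subset I0 ->
  n_below le0 (trace I) s = n_below le I (val s).
Proof.
move=> II0; rewrite /n_below -(card_imset _ val_inj); congr #|pred_of_set _|.
apply/setP=> t; apply/imsetP/idP => [[u]|].
  rewrite !inE => /andP[uI /andP[us ut]] ->.
  have {}ut : le (val u) (val s) by [].
  by rewrite uI ut (inj_eq val_inj) us.
rewrite inE => /andP[tI tst].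
exists (exist (fun s => s \in I0) t (subsetP II0 t tI)) => //.
by rewrite !inE /= tI -(inj_eq val_inj).
Qed.

Lemma mem_F0 I (b : A0) : I \subset I0 -> incl b \in F I -> b \in F0 (trace I).
Proof. by move=> II0 bI; rewrite -(traceK II0) in bI. Qed.

Definition Y_cell i I a b : Y i := tens (a : M) (X_cell F0 i (trace I) 1 (p b)).

Lemma Y_cell_eq0 i I a b : p b = 0 -> Y_cell i I a b = 0.
Proof.
by move=> pb; rewrite /Y_cell pb X_cellr0 (zmod_morph0 (@tensBr _ _ _ _ M (X0 i) a)).
Qed.

Definition proj_part i I : X_obj F I -> Y i :=
  tens_lift (fun (a : X_left F I) (b : X_right F I) =>
    if I \subset I0 then Y_cell i I a b else 0).

Lemma proj_part_balanced i I : balanced (fun (a : X_left F I) (b : X_right F I) =>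
  if I \subset I0 then Y_cell i I a b else 0).
Proof.
case: (boolP (I \subset I0)) => II0; last by split=> *; rewrite ?addr0.
split=> [a a' b|a b b'|a c b].
- exact: (tensDl (a : M) a' _).
- have e : p (b + b') = p b + p b' by exact: zmod_morphD.
  by rewrite /Y_cell e X_cellDr tensDr.
have cI0 : subalg_val c \in F I0 by apply: (sf_mono II0); exact: subalg_valP.
have e : p (lact c b) = Subalg cI0 * p b by exact: (pl (Subalg cI0)).
rewrite /Y_cell e -X_cellM; last by apply: mem_F0 => //; exact: (subalg_valP c).
rewrite mul1r -[Subalg cI0 in RHS]mulr1 -X_cell_lact.
exact: (tensM (a : M) (Subalg cI0)).
Qed.

Lemma proj_partB i I : zmod_morphism (@proj_part i I).
Proof. exact: tens_liftB (proj_part_balanced i I). Qed.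

Lemma proj_part_tens i I a b :
  proj_part i (X_tens F I a b) = if I \subset I0 then Y_cell i I a b else 0.
Proof. exact: (tens_liftE (proj_part_balanced i I)). Qed.

Definition proj_fun i (x : X i) : Y i :=
  \sum_(I : of_card S i) proj_part i (dcoord (M := X_coefSystem F) I x).

Lemma proj_funB i : zmod_morphism (@proj_fun i).
Proof.
apply: zmod_morph_bigsum => I.
exact: zmod_morph_comp (@proj_partB i (val I)) (@dcoordB _ _ _ _ (X_coefSystem F) i I).
Qed.

Lemma proj_cell i I a b : #|I|%:Z = i ->
  proj_fun (X_cell F i I a b) = if I \subset I0 then Y_cell i I a b else 0.
Proof.
move=> Ii; rewrite -proj_part_tens.
exact: (sum_cell Ii (M := X_coefSystem F) (fun J => X_tens F J a b)
  (fun J : of_card S i => @proj_partB i (val J))).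
Qed.

Lemma proj_funl i c (x : X i) : proj_fun (lact c x) = lact c (proj_fun x).
Proof.
move: x; apply: additive_X_cell => [||I a b Ii].
- exact: zmod_morph_comp (@proj_funB i) (@lactBr _ _ _ (X i) c).
- exact: zmod_morph_comp (@lactBr _ _ _ (Y i) c) (@proj_funB i).
rewrite X_cell_lact !proj_cell //; case: ifP => _; last by rewrite raddf0.
by rewrite /Y_cell tensor_lactE.
Qed.

Lemma proj_funr i (x : X i) (c : A0) : proj_fun (ract x (incl c)) = ract (proj_fun x) c.
Proof.
move: x; apply: additive_X_cell => [||I a b Ii].
- exact: zmod_morph_comp (@proj_funB i) (@ractBl _ _ _ (X i) (incl c)).
- exact: zmod_morph_comp (@ractBl _ _ _ (Y i) c) (@proj_funB i).
rewrite X_cell_ract !proj_cell //; case: ifP => _; last by rewrite ract0l.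
by rewrite /Y_cell tensor_ractE X_cell_ract pr.
Qed.

Definition proj_hom i : bimodHom (XR i) (Y i) :=
  @build_hom _ _ _ (XR i) (Y i) (@proj_fun i) (@proj_funB i) (@proj_funl i) (@proj_funr i).

(** The order on I0 is the induced one, so that the signs are those of the large complex. *)
Lemma Y_diff_cell i I a b : I \subset I0 -> #|I|%:Z = i ->
  tensor_hom M (cx_d X0 i) (Y_cell i I a b) =
  \sum_(s : S0 | s \notin trace I) Y_cell (i + 1) (val s |: I) a b *~ (-1) ^+ n_below le I (val s).
Proof.
move=> II0 Ii; rewrite [LHS]tens_homE (X_cell_diff F0 le0); last by rewrite card_trace.
rewrite (zmod_morph_sum _ _ _ (@tensBr _ _ _ _ M (X0 (i + 1)) a)); apply: eq_bigr => s sI.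
rewrite (zmod_morphMz _ _ (@tensBr _ _ _ _ M (X0 (i + 1)) a)) n_below_trace //.
congr (tens _ (X_cell _ _ _ _ _) *~ _).
by apply/setP=> t; rewrite !inE (inj_eq val_inj).
Qed.

(** If s is not in I0, the image of the subset s |: I vanishes, which matches the absence of
    s from the differential of the target. *)
Lemma proj_comm i (x : X i) : proj_fun (cx_d X i x) = cx_d Y i (proj_fun x).
Proof.
move: x; apply: additive_X_cell => [||I a b Ii].
- exact: zmod_morph_comp (@proj_funB (i + 1)) (raddfB (cx_d X i)).
- exact: zmod_morph_comp (raddfB (cx_d Y i)) (@proj_funB i).
rewrite [cx_d X i _](X_cell_diff F le) // (zmod_morph_sum _ _ _ (@proj_funB (i + 1))).
rewrite proj_cell //.
have cardU s : s \notin I -> #|s |: I|%:Z = i + 1.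
  by move=> sI; rewrite cardsU1 sI -Ii; lia.
have e s : s \notin I -> proj_fun (X_cell F (i + 1) (s |: I) a b *~ (-1) ^+ n_below le I s) =
    if (s \in I0) && (I \subset I0) then
      Y_cell (i + 1) (s |: I) a b *~ (-1) ^+ n_below le I s else 0.
  move=> sI; rewrite (zmod_morphMz _ _ (@proj_funB (i + 1))) proj_cell ?cardU //.
  by rewrite subUset sub1set; case: ifP => _ //; rewrite mul0rz.
rewrite (eq_bigr _ e); have [II0|_] := boolP (I \subset I0); last first.
  by rewrite raddf0 big1 // => s _; rewrite andbF.
rewrite [RHS]Y_diff_cell //.
under eq_bigr do rewrite andbT.
rewrite sum_subtype; apply: eq_bigl => s; by rewrite inE.
Qed.

Definition proj_map : chainMap XR Y := @ChainMap _ _ _ XR Y proj_hom proj_comm.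

Lemma proj_cell_lift i (K : {set S0}) a (b c : A0) : #|K|%:Z = i ->
  proj_fun (X_cell F i (val @: K) (a * incl b) (incl c)) = tens (a : M) (X_cell F0 i K b c).
Proof.
move=> Ki; rewrite proj_cell; last by rewrite card_imset //; exact: val_inj.
rewrite imset_sub /Y_cell pK imsetK_trace -[b in RHS]mulr1 -X_cell_lact.
exact: (tensM (a : M) b).
Qed.

Lemma proj_surj i (y : Y i) : exists x : XR i, proj_map i x = y.
Proof.
elim/tens_ind: y => [|y y' [x <-] [x' <-]|a y].
- by exists 0; rewrite raddf0.
- by exists (x - x'); rewrite raddfB.
elim/X_cell_ind: y => [|y y' [x ex] [x' ex']|K b c Ki].
- by exists 0; rewrite raddf0 (zmod_morph0 (@tensBr _ _ _ _ M (X0 i) a)).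
- by exists (x - x'); rewrite raddfB ex ex' (@tensBr _ _ _ _ M (X0 i) a).
by exists (X_cell F i (val @: K) (a * incl b) (incl c)); exact: proj_cell_lift.
Qed.

Definition lift_part i (K : {set S0}) : X_obj F0 K -> X i :=
  tens_lift (fun (b : X_left F0 K) (c : X_right F0 K) => X_cell F i (val @: K) (incl b) (incl c)).

Lemma lift_part_balanced i (K : {set S0}) : balanced (fun (b : X_left F0 K) (c : X_right F0 K) =>
  X_cell F i (val @: K) (incl b) (incl c)).
Proof.
split=> [b b' c|b c c'|b d c].
- by rewrite (raddfD incl) X_cellDl.
- by rewrite (raddfD incl) X_cellDr.
- have e1 : incl (ract b d) = incl b * incl (subalg_incl d) by exact: rmorphM.
  have e2 : incl (lact d c) = incl (subalg_incl d) * incl c by exact: rmorphM.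
  by rewrite e1 e2 X_cellM //; exact: (subalg_valP d).
Qed.

Definition lift_sum i (y : X0 i) : X i :=
  \sum_(K : of_card S0 i) lift_part i (dcoord (M := X_coefSystem F0) K y).

Lemma lift_partB i K : zmod_morphism (@lift_part i K).
Proof. exact: tens_liftB (lift_part_balanced i K). Qed.

Lemma lift_part_tens i (K : {set S0}) (b c : A0) :
  lift_part i (X_tens F0 K b c) = X_cell F i (val @: K) (incl b) (incl c).
Proof. exact: (tens_liftE (lift_part_balanced i K)). Qed.

Lemma lift_sumB i : zmod_morphism (@lift_sum i).
Proof.
apply: zmod_morph_bigsum => K.
exact: zmod_morph_comp (@lift_partB i (val K)) (@dcoordB _ _ _ _ (X_coefSystem F0) i K).
Qed.

Lemma lift_sum_cell i (K : {set S0}) (b c : A0) : #|K|%:Z = i ->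
  lift_sum (X_cell F0 i K b c) = X_cell F i (val @: K) (incl b) (incl c).
Proof.
move=> Ki; rewrite -lift_part_tens.
exact: (sum_cell Ki (M := X_coefSystem F0) (fun L : {set S0} => X_tens F0 L b c)
  (fun L : of_card S0 i => @lift_partB i (val L))).
Qed.

Lemma lift_suml i (b : A0) (y : X0 i) : lift_sum (lact b y) = lact (incl b) (lift_sum y).
Proof.
move: y; apply: additive_X_cell => [||K c d Ki].
- exact: zmod_morph_comp (@lift_sumB i) (@lactBr _ _ _ (X0 i) b).
- exact: zmod_morph_comp (@lactBr _ _ _ (X i) (incl b)) (@lift_sumB i).
by rewrite X_cell_lact !lift_sum_cell // X_cell_lact (rmorphM incl).
Qed.

(** The map a (x) (b (x)_K c) -> a b (x)_K c in the opposite direction. It does not commute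
    with the differentials: it only serves to recognize the kernel of the projection. *)
Definition proj_section i : Y i -> X i :=
  tens_lift (fun (a : M) (y : X0 i) => lact (a : A) (lift_sum y)).

Lemma proj_section_balanced i :
  balanced (fun (a : M) (y : X0 i) => lact (a : A) (lift_sum y)).
Proof.
split=> [a a' y|a y y'|a b y].
- exact: lactDl.
- by rewrite (zmod_morphD (@lift_sumB i)) lactDr.
- by rewrite lift_suml -lactM.
Qed.

Lemma proj_sectionB i : zmod_morphism (@proj_section i).
Proof. exact: tens_liftB (proj_section_balanced i). Qed.

Lemma proj_section_cell i I a b : I \subset I0 -> #|I|%:Z = i ->
  proj_section (Y_cell i I a b) = X_cell F i I a (incl (p b)).
Proof.
move=> II0 Ii; rewrite [LHS](tens_liftE (proj_section_balanced i)).
by rewrite lift_sum_cell ?card_trace // X_cell_lact traceK // (rmorph1 incl) mulr1.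
Qed.

End Projection.

(** * The partial contraction of the Hecke complex *)

Section HeckeContraction.
Variables (W : finGroupType) (S : {set W}) (cox : coxeter_system S).
Variables (R : comUnitRingType) (q : gens S -> R) (H : algType R) (h : W -> H).
Hypothesis q_unit : forall s, q s \is a GRing.unit.
Hypothesis hH : is_hecke q h.
Variable I0 : {set gens S}.
Implicit Types (u v w x : W) (s t : gens S) (I J : {set gens S}) (a b y z : H).
Local Notation len := (cox_length S).
Local Notation inversion := (inversion cox).
Local Notation F := (hecke_family cox q_unit hH).
Local Notation hinv := (hecke_inv cox q_unit hH).
Local Notation steep w := (steep cox I0 w).

Section Theta.
Variables (J I : {set gens S}) (s : gens S) (V : bimodule H H) (T : H -> H -> V).
Hypothesis Tl : forall c a b, lact c (T a b) = T (c * a) b.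
Hypothesis Tr : forall a b c, ract (T a b) c = T a (b * c).
Hypothesis TDr : forall a b b', T a (b + b') = T a b + T a b'.
Hypothesis TM : forall a b c, b \in F I -> T (a * b) c = T a (b * c).

(** The values on the basis of the left H_J-linear map that sends h_w to 1 (x) h_w when w is
    maximal in W_J w with steep reflection s, and to 0 for the other maximal w. *)
Definition theta_basis v : V :=
  if steep (coset_top J v) == Some s
  then T (hinv (v * (coset_top J v)^-1)%g) (h (coset_top J v)) else 0.

Definition theta : H -> V := linear_ext hH theta_basis.

Lemma thetaD : {morph theta : y z / y + z}.
Proof. exact: linear_extD. Qed.

Lemma thetaZ r y : theta (r *: y) = lact r%:A (theta y).
Proof. exact: linear_extZ. Qed.

Lemma theta_coset u w : coset_max J w -> u \in parabolic J ->
  theta (h (u * w)%g) = if steep w == Some s then T (hinv u) (h w) else 0.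
Proof.
move=> wmax uJ; rewrite /theta linear_ext_basis /theta_basis.
by rewrite (coset_topE cox wmax uJ) mulgK.
Qed.

Lemma theta_max w : coset_max J w ->
  theta (h w) = if steep w == Some s then T 1 (h w) else 0.
Proof. by move=> wmax; rewrite -(hecke_inv1 cox q_unit hH) -theta_coset ?group1 ?mul1g. Qed.

Lemma TZ (r : R) a b : T a (r *: b) = lact r%:A (T a b).
Proof. by rewrite lractC Tr mulr_algr. Qed.

Lemma lact_algC (r : R) c (x : V) : lact c (lact r%:A x) = lact r%:A (lact c x).
Proof. by rewrite -!lactM mulr_algl mulr_algr. Qed.

Lemma lactD_alg (r r' : R) (c : H) (x : V) :
  lact (r *: c + r'%:A) x = lact r%:A (lact c x) + lact r'%:A x.
Proof. by rewrite lactDl -[in LHS](mulr_algl r c) lactM. Qed.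

(** When t v is longer than v = u w, with w maximal and u in W_J, t u is shorter than u:
    the lengths of u and u w have a constant sum. *)
Lemma theta_lact_ascent t v : t \in J -> ~~ inversion v (val t) ->
  theta (h (val t * v)%g) = lact (h (val t)) (theta (h v)).
Proof.
move=> tJ vt; have [wmax [u uJ ev]] := coset_topP J v.
move: (coset_top J v) wmax ev => w wmax ev; rewrite {}ev in vt *.
have tuJ : (val t * u)%g \in parabolic J by rewrite groupM // mem_parabolic.
have ut : inversion u (val t).
  have e1 := coset_max_len cox wmax uJ; have e2 := coset_max_len cox wmax tuJ.
  rewrite -mulgA (len_gen_noninversion (valP t) vt) in e2.
  rewrite -(len_gen_inversion cox u (valP t)); move: e1 e2; len_lia.
rewrite mulgA !theta_coset //; case: ifP => _; last by rewrite raddf0.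
by rewrite hecke_inv_descent // Tl.
Qed.

Lemma theta_lact_gen t y : t \in J -> theta (h (val t) * y) = lact (h (val t)) (theta y).
Proof.
move=> tJ; elim/(hecke_linear_ind hH): y => [y z IHy IHz|r y IHy|v].
- by rewrite mulrDr !thetaD lactDr IHy IHz.
- by rewrite -scalerAr !thetaZ IHy lact_algC.
have [vt|vt] := boolP (inversion v (val t)); last first.
  by rewrite (hecke_ascent hH) // theta_lact_ascent.
have vt' : ~~ inversion (val t * v)%g (val t).
  by rewrite -(len_gen_inversion cox _ (valP t)) (gen_mulK cox) -leqNgt ltnW //
    (len_gen_inversion cox _ (valP t)).
rewrite (hecke_gen_descent hH vt) thetaD !thetaZ.
have -> : theta (h v) = lact (h (val t)) (theta (h (val t * v)%g)).
  by rewrite -theta_lact_ascent // (gen_mulK cox).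
by rewrite -lactD_alg -(hecke_quad hH) expr2 lactM.
Qed.

Lemma theta_lact b y : b \in F J -> theta (b * y) = lact b (theta y).
Proof.
move=> bJ; elim/(hecke_sub_ind cox q_unit hH): b / bJ y => [|b b' IHb IHb'|r b IHb|t b tJ IHb] y.
- by rewrite mul1r lact1.
- by rewrite mulrDl thetaD IHb IHb' lactDl.
- by rewrite -scalerAl thetaZ IHb -lactM mulr_algl.
- by rewrite -mulrA theta_lact_gen // IHb lactM.
Qed.

Hypothesis JI : J \subset s |: I.

(** If w t is maximal in its coset, both sides are computed on basis elements with the same
    steep reflection. Otherwise w t = s' w with s' in J, so that h_w h_t = h_s' h_w, and it
    remains to see that s' is not s: s lowers the whole coset w W_I0 and s' does not lower
    w t. *)
Lemma theta_ract_max t w : t \in I0 -> coset_max J w ->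
  theta (h w * h (val t)) = ract (theta (h w)) (h (val t)).
Proof.
move=> tI wmax; have tI0 := mem_parabolic tI.
have ext : ract (theta (h w)) (h (val t)) =
    if steep w == Some s then T 1 (h w * h (val t)) else 0.
  rewrite theta_max //; case: ifP => _; first exact: Tr.
  exact: ract0l.
rewrite {}ext; have [wtmax|] := boolP (coset_max J (w * val t)%g).
  have e : theta (h (w * val t)%g) =
      if steep w == Some s then T 1 (h (w * val t)%g) else 0.
    by rewrite theta_max // steepM.
  have [wt|wt] := boolP (inversion w^-1 (val t)); last by rewrite (hecke_right_ascent hH).
  rewrite (hecke_right_gen_descent hH) // thetaD !thetaZ e theta_max //.
  case: ifP => _; last by rewrite !raddf0 addr0.
  by rewrite TDr !TZ.
move=> nmax; have [s' s'J] : exists2 s' : gens S, s' \in J & ~~ inversion (w * val t)%g (val s').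
  apply/exists_inP; apply: contraR nmax; rewrite negb_exists_in => /forall_inP nt.
  by apply/coset_max_descents => s' /nt; rewrite negbK.
move=> wts'; have ws' : inversion w (val s') by apply: coset_max_descents s'J.
have efold := inversion_fold (valP s') (valP t) ws' wts'.
have wt : inversion w^-1 (val t).
  rewrite -(len_gen_inversion cox _ (valP t)) -(len_gen_right cox) -efold (lenV cox).
  by rewrite (len_gen_inversion cox _ (valP s')).
have e : h w * h (val t) = h (val s') * h w.
  rewrite [in RHS](hecke_right_descent hH wt) -efold mulrA.
  by rewrite -(hecke_descent hH ws').
rewrite e theta_lact_gen // theta_max //; case: eqP => [ews|_]; last exact: raddf0.
have s's : s' != s.
  by apply: contraNneq wts' => ->; have [_] := steep_some ews; apply.
have s'I : s' \in I by have := subsetP JI s' s'J; rewrite in_setU1 (negbTE s's).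
by rewrite Tl mulr1 -TM ?mul1r //; exact: (hecke_span_basis h (mem_parabolic s'I)).
Qed.

Lemma theta_ract_gen t y : t \in I0 -> theta (y * h (val t)) = ract (theta y) (h (val t)).
Proof.
move=> tI; elim/(hecke_linear_ind hH): y => [y z IHy IHz|r y IHy|v].
- by rewrite mulrDl !thetaD ractDl IHy IHz.
- by rewrite -scalerAl !thetaZ IHy lractA.
have [wmax [u uJ ->]] := coset_topP J v.
rewrite (coset_max_hecke cox q_unit hH wmax uJ) -mulrA.
have uF : hinv u \in F J by apply: hecke_inv_sub.
by rewrite !(theta_lact _ uF) theta_ract_max // lractA.
Qed.

Lemma theta_ract b y : b \in F I0 -> theta (y * b) = ract (theta y) b.
Proof.
move=> bI; elim/(hecke_sub_ind cox q_unit hH): b / bI y => [|b b' IHb IHb'|r b IHb|t b tI IHb] y.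
- by rewrite mulr1 ract1.
- by rewrite mulrDr thetaD IHb IHb' ractDr.
- by rewrite -scalerAr thetaZ IHb lractC -ractM mulr_algr.
- by rewrite mulrA IHb theta_ract_gen // ractM.
Qed.

End Theta.

(** For J = s |: I, the unsigned contraction. *)
Definition kappa J I s : X_obj F J -> X_obj F I :=
  tens_lift (fun (a : X_left F J) (b : X_right F J) => lact (a : H) (theta J s (X_tens F I) b)).

Lemma kappa_balanced J I s :
  balanced (fun (a : X_left F J) (b : X_right F J) => lact (a : H) (theta J s (X_tens F I) b)).
Proof.
split=> [a a' b|a b b'|a c b].
- exact: lactDl.
- by rewrite thetaD lactDr.
- rewrite [RHS](congr1 (lact a) (theta_lact s (X_lactE F I) b (subalg_valP c))).
  by rewrite -lactM.
Qed.

Lemma kappaB J I s : zmod_morphism (@kappa J I s).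
Proof. exact: tens_liftB (kappa_balanced J I s). Qed.

Lemma kappa_tens J I s a b : kappa I s (X_tens F J a b) = lact a (theta J s (X_tens F I) b).
Proof. exact: (tens_liftE (kappa_balanced J I s)). Qed.

Lemma kappal J I s c (p : X_obj F J) : kappa I s (lact c p) = lact c (kappa I s p).
Proof.
move: p; apply: eq_additive_X => [||a b].
- exact: zmod_morph_comp (@kappaB J I s) (lactBr c).
- exact: zmod_morph_comp (lactBr c) (@kappaB J I s).
- by rewrite X_lactE !kappa_tens lactM.
Qed.

Lemma kappar I s (p : X_obj F (s |: I)) (c : subalg (F I0)) :
  kappa I s (ract p (subalg_incl c)) = ract (kappa I s p) (subalg_incl c).
Proof.
move: p; apply: eq_additive_X => [||a b].
- exact: zmod_morph_comp (@kappaB _ I s) (ractBl _).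
- exact: zmod_morph_comp (ractBl _) (@kappaB _ I s).
- rewrite X_ractE !kappa_tens.
  rewrite (theta_ract (X_lactE F I) (X_ractE F I) (X_tensDr F I)
    (@X_tensM _ _ _ F I) (subxx _) b (subalg_valP c)).
  by rewrite lractA.
Qed.

Lemma kappa_max J I s a w : coset_max J w ->
  kappa I s (X_tens F J a (h w)) = if steep w == Some s then X_tens F I a (h w) else 0.
Proof.
move=> wmax; rewrite kappa_tens theta_max //; case: ifP => _; last exact: raddf0.
by rewrite X_lactE mulr1.
Qed.

End HeckeContraction.

(** * Nilpotency of the perturbation *)

Section Nilpotency.
Variables (W : finGroupType) (S : {set W}) (cox : coxeter_system S).
Variables (R : comUnitRingType) (q : gens S -> R) (H : algType R) (h : W -> H).
Hypothesis q_unit : forall s, q s \is a GRing.unit.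
Hypothesis hH : is_hecke q h.
Variables (le : totalOrder (gens S)) (I0 : {set gens S}).
Implicit Types (u v w : W) (s t : gens S) (I J : {set gens S}) (a b : H) (i : int).
Local Notation len := (cox_length S).
Local Notation inversion := (inversion cox).
Local Notation F := (hecke_family cox q_unit hH).
Local Notation steep w := (steep cox I0 w).
Local Notation hinv := (hecke_inv cox q_unit hH).
Local Notation X := (X_complex F le).
Local Notation D i := (cx_d X i).

Lemma hecke_proj_subproof y : parabolic_proj hH I0 y \in F I0.
Proof. exact: parabolic_proj_in. Qed.

Definition hecke_proj (y : H) : subalg (F I0) := Subalg (hecke_proj_subproof y).

Lemma hecke_projB : zmod_morphism hecke_proj.
Proof. by apply: additive_zmod_morphism => y z; apply: val_inj; exact: parabolic_projD. Qed.

Lemma hecke_projl (b : subalg (F I0)) a :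
  hecke_proj (subalg_incl b * a) = b * hecke_proj a.
Proof.
by apply: val_inj; rewrite rmorphM /=; exact: (parabolic_projMl cox q_unit hH a (subalg_valP b)).
Qed.

Lemma hecke_projr a (b : subalg (F I0)) :
  hecke_proj (a * subalg_incl b) = hecke_proj a * b.
Proof.
by apply: val_inj; rewrite rmorphM /=; exact: (parabolic_projMr cox q_unit hH a (subalg_valP b)).
Qed.

Lemma hecke_projK (b : subalg (F I0)) : hecke_proj (subalg_incl b) = b.
Proof.
rewrite -[subalg_incl b]mulr1 hecke_projl; suff -> : hecke_proj 1 = 1 by rewrite mulr1.
apply: val_inj; rewrite rmorph1 /= -(hecke1 hH) parabolic_proj_basis group1.
by [].
Qed.

(** The degree -1 map k, on components. *)
Definition contract i : X (i + 1) -> X i :=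
  contraction_fun (M := X_coefSystem F) le
    (fun J I s => @kappa _ _ cox _ _ _ _ q_unit hH I0 J I s) (i := i).

Lemma contractB i : zmod_morphism (@contract i).
Proof. by apply: contractionB => I s; exact: kappaB. Qed.

Lemma contract_cell i J a w : #|J|%:Z = i + 1 -> coset_max J w ->
  contract (X_cell F (i + 1) J a (h w)) =
  if steep w is Some s then
    if s \in J then X_cell F i (J :\ s) a (h w) *~ (-1) ^+ n_below le (J :\ s) s else 0
  else 0.
Proof.
move=> Ji wmax; apply: (cell_contraction (M := X_coefSystem F)) => //.
  by move=> I s; exact: kappaB.
by move=> I s eJ; exact: kappa_max.
Qed.

Lemma contract_parabolic i J a w : #|J|%:Z = i + 1 -> coset_max J w -> w \in parabolic I0 ->
  contract (X_cell F (i + 1) J a (h w)) = 0.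
Proof. by move=> Ji wmax wI; rewrite contract_cell //; case: steepP => // s; rewrite wI. Qed.

Lemma X_cell_top i I a w : exists a', X_cell F i I a (h w) = X_cell F i I a' (h (coset_top I w)).
Proof.
have [wmax [u uI ew]] := coset_topP I w; exists (a * hinv u).
rewrite X_cellM; last by apply: hecke_inv_sub.
by rewrite -(coset_max_hecke cox q_unit hH wmax uI) -ew.
Qed.

(** For u in W_I and w maximal, h_{u w} is the product of an element of H_I and h_w, and the
    former moves to the left factor of the tensor. *)
Lemma X_max_ind i (P : X i -> Prop) : P 0 -> (forall x y, P x -> P y -> P (x - y)) ->
  (forall I a w, #|I|%:Z = i -> coset_max I w -> P (X_cell F i I a (h w))) ->
  forall x, P x.
Proof.
move=> P0 PB Pc; apply: X_cell_ind => // I a b Ii.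
have PD y z : P y -> P z -> P (y + z).
  by move=> Py Pz; rewrite -[z]opprK; apply: (PB) => //; rewrite -[- z]add0r; apply: PB.
elim/(hecke_linear_ind hH): b a => [b b' IHb IHb'|r b IHb|w] a.
- by rewrite X_cellDr; apply: PD.
- rewrite -mulr_algl -X_cellM ?rpredZ ?rpred1 //.
have [a' ->] := X_cell_top i I a w.
by apply: Pc => //; have [] := coset_topP I w.
Qed.

Lemma coset_maxU s I w : coset_max I w -> coset_max (s |: I) w = inversion w (val s).
Proof.
move=> /(coset_max_descents cox) wI; apply/(coset_max_descents cox)/idP => [ws|ws t].
  by apply: ws; rewrite setU11.
by rewrite in_setU1 => /orP[/eqP->|/wI].
Qed.

Lemma coset_maxS I J w : I \subset J -> coset_max J w -> coset_max I w.
Proof.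
move=> IJ /(coset_max_descents cox) wJ; apply/(coset_max_descents cox) => s sI.
by apply: wJ; exact: (subsetP IJ).
Qed.

(** The subgroup generated by the a (x)_I h_w, with w maximal in W_I w, outside W_I0 and of
    length at least m. It is not meant to be a sub-bimodule: right multiplication may
    shorten w. *)
Inductive deep m i : X i -> Prop :=
| deep0 : deep m 0
| deepB x y : deep m x -> deep m y -> deep m (x - y)
| deepC I a w : #|I|%:Z = i -> coset_max I w -> w \notin parabolic I0 ->
    (m <= len w)%N -> deep m (X_cell F i I a (h w)).

Lemma deepN m i (x : X i) : deep m x -> deep m (- x).
Proof. by move=> xm; rewrite -sub0r; apply: deepB => //; exact: deep0. Qed.

Lemma deepD m i (x y : X i) : deep m x -> deep m y -> deep m (x + y).
Proof. by move=> xm ym; rewrite -[y]opprK; apply/deepB/deepN. Qed.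

Lemma deep_sum m i (T : Type) (r : seq T) (P : pred T) (G : T -> X i) :
  (forall j, P j -> deep m (G j)) -> deep m (\sum_(j <- r | P j) G j).
Proof.
by move=> Gm; elim/big_ind: _ => //; [exact: deep0 | exact: deepD].
Qed.

Lemma deep_sign m i (x : X i) n : deep m x -> deep m (x *~ (-1) ^+ n).
Proof.
move=> xm; rewrite -signr_odd; case: odd; rewrite ?expr0 ?expr1 ?mulr1z //.
by rewrite mulrN1z; exact: deepN.
Qed.

(** Passing to the maximal element of the coset strictly increases the length. *)
Lemma deep_cell m i I a w : #|I|%:Z = i -> w \notin parabolic I0 ->
  (m <= len w)%N -> ~~ coset_max I w -> deep m.+1 (X_cell F i I a (h w)).
Proof.
move=> Ii wI0 mw wmax; have [a' ->] := X_cell_top i I a w.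
apply: deepC => //; first by have [] := coset_topP I w.
- by apply: contra wI0; exact: coset_top_parabolic.
- exact: leq_ltn_trans mw (len_coset_top cox wmax).
Qed.

Lemma deep_contract m i (x : X (i + 1)) : deep m x -> deep m (contract x).
Proof.
elim=> [|y z _ Ky _ Kz|I a w Ii wmax wI0 mw].
- by rewrite (zmod_morph0 (@contractB i)); exact: deep0.
- by rewrite (@contractB i); exact: deepB.
rewrite contract_cell //; case: (steep w) => [s|]; last exact: deep0.
case: ifP => sI; last exact: deep0.
apply/deep_sign/deepC => //; last exact: coset_maxS (subsetDl _ _) wmax.
by have := cardsD1 s I; rewrite sI; lia.
Qed.

Lemma deep_large m i (x : X i) : (\max_w len w < m)%N -> deep m x -> x = 0.
Proof.
move=> lm; elim=> [//|y z _ -> _ ->|I a w _ _ _ mw]; first by rewrite subr0.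
by have := leq_bigmax (F := fun w => len w) w; rewrite leqNgt (leq_trans lm mw).
Qed.

Lemma subrACA (V : zmodType) (a b c d : V) : a - b - (c - d) = a - c - (b - d).
Proof. by rewrite !opprB addrACA [RHS]addrACA; congr (_ + _); rewrite addrC. Qed.

Lemma pert_rearrange (V : zmodType) (a b c d e f : V) :
  a - b - (c - d) - (e - f) = a - c - e - (b - d - f).
Proof. by rewrite (subrACA a b c d) subrACA. Qed.

Definition pert i (x : X (i + 1)) : X (i + 1) := x - D i (contract x) - contract (D (i + 1) x).

Lemma sign_sq (V : zmodType) (x : V) n : x *~ (-1) ^+ n *~ (-1) ^+ n = x.
Proof. by rewrite -mulrzA -expr2 sqrr_sign mulr1z. Qed.

Lemma cancel_lead0 (V : zmodType) (x y : V) : x - 0 - (x + y) = - y.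
Proof. by rewrite subr0 opprD addrA subrr sub0r. Qed.

Lemma cancel_lead (V : zmodType) (x y z : V) : x - (x + y) - z = - (y + z).
Proof. by rewrite opprD addrA subrr sub0r opprD. Qed.

(** Removing s and adding t anticommute. *)
Lemma sign_anticomm (V : zmodType) (x : V) s t I : s \in I -> t \notin I ->
  x *~ (-1) ^+ n_below le (I :\ s) t *~ (-1) ^+ n_below le (I :\ s) s +
  x *~ (-1) ^+ n_below le (t |: (I :\ s)) s *~ (-1) ^+ n_below le I t = 0.
Proof.
move=> sI tI; have ts : t != s by apply: contraNneq tI => ->.
have tI' : t \notin I :\ s by rewrite in_setD1 negb_and tI orbT.
have sI' : s \notin I :\ s by rewrite setD11.
have -> : n_below le I t = (le s t + n_below le (I :\ s) t)%N.
  by rewrite -{1}(setD1K sI) n_belowU // eq_sym.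
rewrite n_belowU // -!mulrzA -mulrzDr -!exprD (le_xor le ts).
set n1 := n_below _ _ t; set n2 := n_below _ _ s.
rewrite !exprD; case: (le t s); rewrite /= ?expr0 ?expr1 ?mul1r ?mulN1r ?mulrN ?mulNr.
  by rewrite [(-1) ^+ n2 * _]mulrC subrr mulr0z.
by rewrite [(-1) ^+ n2 * _]mulrC subrr mulr0z.
Qed.

(** Let s be the steep reflection of w. The term t = s of the differential gives back
    a (x)_I h_w, either in k d or in d k according to whether s belongs to I. For t
    different from s, if t is a descent of w then w is still maximal after adding t, and the
    terms of d k and k d cancel; otherwise all terms are in the next layer. *)
Lemma pert_cell m i I a w : #|I|%:Z = i + 1 -> coset_max I w -> w \notin parabolic I0 ->
  (m <= len w)%N -> deep m.+1 (pert (X_cell F (i + 1) I a (h w))).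
Proof.
move=> Ii wmax wI0 mw; have ews : exists s, steep w = Some s.
  by case: steepP => [s|]; [exists s | rewrite (negbTE wI0)].
case: ews => s es; have [_ /(_ 1%g (group1 _))] := steep_some es; rewrite mulg1 => ws.
have cardU t (J : {set gens S}) j : #|J|%:Z = j -> t \notin J -> #|t |: J|%:Z = j + 1.
  by move=> Jj tJ; rewrite cardsU1 tJ -Jj; lia.
have cI t : t \notin I -> #|t |: I|%:Z = i + 1 + 1 by exact: cardU.
have KD : contract (D (i + 1) (X_cell F (i + 1) I a (h w))) =
    \sum_(t | t \notin I)
      contract (X_cell F (i + 1 + 1) (t |: I) a (h w)) *~ (-1) ^+ n_below le I t.
  rewrite [cx_d X _ _](X_cell_diff F le) // (zmod_morph_sum _ _ _ (@contractB (i + 1))).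
  by apply: eq_bigr => t tI; rewrite (zmod_morphMz _ _ (@contractB (i + 1))).
(* Adding t moves w away from the top of its coset, hence to the next layer. *)
have Kflat t : t \notin I -> ~~ inversion w (val t) ->
    deep m.+1 (contract (X_cell F (i + 1 + 1) (t |: I) a (h w))).
  by move=> tI wt; apply: deep_contract; apply: deep_cell => //;
    [exact: cardU | rewrite coset_maxU].
rewrite /pert KD contract_cell // es; case: ifP => sI; last first.
  have {}sI : s \notin I by rewrite sI.
  have Ks : contract (X_cell F (i + 1 + 1) (s |: I) a (h w)) *~ (-1) ^+ n_below le I s =
      X_cell F (i + 1) I a (h w).
    by rewrite contract_cell ?cI ?coset_maxU // es setU11 setU1K // sign_sq.
  rewrite (raddf0 (D i)) (bigD1 s sI) Ks cancel_lead0.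
  apply: deepN; apply: deep_sum => t /andP[tI ts]; apply: deep_sign.
  have [wt|wt] := boolP (inversion w (val t)); last exact: Kflat.
  rewrite contract_cell ?cI ?coset_maxU // es in_setU1 eq_sym (negbTE ts) (negbTE sI).
  exact: deep0.
have eI : s |: (I :\ s) = I by exact: setD1K.
have I'i : #|I :\ s|%:Z = i by have := cardsD1 s I; rewrite sI; lia.
have DK : D i (X_cell F i (I :\ s) a (h w) *~ (-1) ^+ n_below le (I :\ s) s) =
    X_cell F (i + 1) I a (h w) +
    \sum_(t | t \notin I) X_cell F (i + 1) (t |: (I :\ s)) a (h w)
      *~ (-1) ^+ n_below le (I :\ s) t *~ (-1) ^+ n_below le (I :\ s) s.
  have e := @X_cell_diff _ _ _ F le i (I :\ s) a (h w) I'i.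
  rewrite (raddfMz (D i)) [cx_d X _ _]e (bigD1 s) ?setD11 // eI mulrzDl sign_sq mulrz_suml.
  congr (_ + _); apply: eq_bigl => t.
  by rewrite in_setD1 negb_and negbK; case: eqP => [->|]; rewrite ?sI ?andbT.
rewrite DK cancel_lead -big_split; apply: deepN; apply: deep_sum => t tI.
have ts : t != s by apply: contraNneq tI => ->.
have tI' : t \notin I :\ s by rewrite in_setD1 negb_and tI orbT.
have sI' : s \notin I :\ s by rewrite setD11.
have [wt|wt] := boolP (inversion w (val t)); last first.
  apply: deepD; last exact/deep_sign/Kflat.
  do 2!apply: deep_sign; apply: deep_cell => //; first exact: cardU.
  by rewrite coset_maxU // (coset_maxS _ wmax) // subsetDl.
rewrite contract_cell ?cI ?coset_maxU // es in_setU1 sI orbT.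
have -> : (t |: I) :\ s = t |: (I :\ s).
  by apply/setP=> r; rewrite !inE; case: (eqVneq r s) => [->|_] //=; rewrite eq_sym (negbTE ts).
have e := sign_anticomm (X_cell F (i + 1) (t |: (I :\ s)) a (h w)) sI tI.
rewrite [Z in deep _ Z]e; exact: deep0.
Qed.

Lemma pert_deep m i (x : X (i + 1)) : deep m x -> deep m.+1 (pert x).
Proof.
have pertB : zmod_morphism (@pert i).
  move=> y z.
  have e1 : D i (contract (y - z)) = D i (contract y) - D i (contract z).
    by rewrite (@contractB i) (raddfB (D i)).
  have e2 : contract (D (i + 1) (y - z)) = contract (D (i + 1) y) - contract (D (i + 1) z).
    by rewrite (raddfB (D (i + 1))) (@contractB (i + 1)).
  rewrite /pert e1 e2.
  exact: (@pert_rearrange (X (i + 1)) y z (D i (contract y)) (D i (contract z))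
    (contract (D (i + 1) y)) (contract (D (i + 1) z))).
elim=> [|y z _ IHy _ IHz|I a w Ii wmax wI0 mw]; last exact: pert_cell.
- by rewrite (zmod_morph0 pertB); exact: deep0.
- by rewrite pertB; exact: deepB.
Qed.

Local Notation incl := (subalg_incl (B := F I0)).
Local Notation XR := (restrict_complex idfun incl X).
Local Notation X0 := (X_complex (sub_family F I0) (induced_order (mem I0) le)).
Local Notation Y := (tensor_complex (restrict idfun incl (regular_bimodule H)) X0).

Definition hecke_contraction i : bimodHom (XR (i + 1)) (XR i) :=
  contraction (M := X_coefSystem F) le
    (fun I s => @kappaB _ _ cox _ _ _ _ q_unit hH I0 (s |: I) I s)
    (fun I s => @kappal _ _ cox _ _ _ _ q_unit hH I0 (s |: I) I s)
    (fun I s => @kappar _ _ cox _ _ _ _ q_unit hH I0 I s) i.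

Lemma perturbationE i (x : XR (i + 1)) : perturbation hecke_contraction i x = pert x.
Proof. by []. Qed.

Lemma iter_perturbation_deep n i (x : XR (i + 1)) :
  deep 0 x -> deep n (hom_iter (perturbation hecke_contraction i) n x).
Proof.
move=> x0; elim: n => [//|n IHn].
change (deep n.+1 (perturbation hecke_contraction i
  (hom_iter (perturbation hecke_contraction i) n x))).
by rewrite perturbationE; apply: pert_deep.
Qed.

Definition hecke_proj_map : chainMap XR Y :=
  proj_map le hecke_projB hecke_projl hecke_projr.

Lemma proj_map_surj i (y : Y i) : exists x, hecke_proj_map i x = y.
Proof. by apply: proj_surj; exact: hecke_projK. Qed.

Lemma hecke_proj_basis w : hecke_proj (h w) = if w \in parabolic I0 then hecke_proj (h w) else 0.
Proof.
case: ifP => // wI; apply: val_inj.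
by rewrite raddf0 /= parabolic_proj_basis wI.
Qed.

(** The elements of I are inversions of w, hence lie in W_I0. *)
Lemma coset_max_sub I w : coset_max I w -> w \in parabolic I0 -> I \subset I0.
Proof.
move=> /(coset_max_descents cox) wI wI0; apply/subsetP=> s sI.
rewrite -(mem_parabolic_gen cox); exact: inversion_parabolic wI0 (wI s sI).
Qed.

Lemma proj_map_deep i I a w : #|I|%:Z = i -> w \notin parabolic I0 ->
  hecke_proj_map i (X_cell F i I a (h w)) = 0.
Proof.
move=> Ii wI0; rewrite [LHS](proj_cell le hecke_projB hecke_projl) //; case: ifP => // _.
by rewrite Y_cell_eq0 // hecke_proj_basis (negbTE wI0).
Qed.

Lemma proj_map_contraction i (x : XR (i + 1)) :
  hecke_proj_map i (hecke_contraction i x) = 0.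
Proof.
elim/X_max_ind: x => [|x y Kx Ky|I a w Ii wmax].
- by rewrite !raddf0.
- by rewrite !raddfB Kx Ky subrr.
have [wI0|wI0] := boolP (w \in parabolic I0).
  by rewrite [hecke_contraction i _](contract_parabolic a Ii wmax wI0) raddf0.
rewrite [hecke_contraction i _](contract_cell a Ii wmax).
case: (steep w) => [s|]; last exact: raddf0.
case: ifP => sI; last exact: raddf0.
rewrite raddfMz proj_map_deep ?mul0rz //.
by have := cardsD1 s I; rewrite sI; lia.
Qed.

(** On generators, x minus the section of its image is deep: the image is zero when w is
    outside W_I0, and otherwise I is contained in I0 and the section gives x back. *)
Lemma proj_map_kernel i (x : XR i) : hecke_proj_map i x = 0 -> deep 0 x.
Proof.
move=> fx0; suff : deep 0 (x - proj_section (le := le) (hecke_proj_map i x)).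
  by rewrite fx0 (zmod_morph0 (@proj_sectionB _ _ _ F le I0 i)) subr0.
elim/X_max_ind: x {fx0} => [|x y dx dy|I a w Ii wmax].
- by rewrite raddf0 (zmod_morph0 (@proj_sectionB _ _ _ F le I0 i)) subr0; exact: deep0.
- rewrite raddfB (@proj_sectionB _ _ _ F le I0 i) subrACA; exact: deepB.
have [wI0|wI0] := boolP (w \in parabolic I0); last first.
  rewrite proj_map_deep // (zmod_morph0 (@proj_sectionB _ _ _ F le I0 i)) subr0.
  exact: deepC.
have II0 := coset_max_sub wmax wI0.
rewrite [hecke_proj_map i _](proj_cell le hecke_projB hecke_projl) // II0 proj_section_cell //.
have -> : incl (hecke_proj (h w)) = h w.
  by rewrite /incl /= parabolic_proj_basis wI0.
by rewrite subrr; exact: deep0.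
Qed.

Lemma X_Kb_object : Kb_object XR.
Proof.
split.
  exists #|gens S| => i ni x; elim/X_cell_ind: x => [//|x y -> ->|I a b Ii]; first by rewrite subr0.
  have iS : (`|i| <= #|gens S|)%N by rewrite -Ii; exact: max_card.
  by rewrite ltnNge iS in ni.
move=> i; exists [seq X_cell F i Iw.1 1 (h Iw.2) | Iw : {set gens S} * W] => P [P0 PD Pl Pr] Pg.
apply: X_max_ind => // [x y Px Py|I a w Ii _].
  by rewrite -[- y]lactN1; apply: PD => //; exact: Pl.
have := Pl a _ (Pg (X_cell F i I 1 (h w)) _).
rewrite [lact _ _]X_cell_lact mulr1; apply.
by apply/imageP; exists (I, w).
Qed.

End Nilpotency.

Theorem theorem17 (W : finGroupType) (S : {set W}) (cox : coxeter_system S)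
  (R : comUnitRingType) (q : gens S -> R)
  (q_unit : forall s, q s \is a GRing.unit)
  (q_conj : forall s t : gens S, (exists w : W, val t = (val s ^ w)%g) -> q s = q t)
  (H : algType R) (h : W -> H) (hH : is_hecke q h)
  (le : totalOrder (gens S)) (I0 : {set gens S}) :
  let HI := hecke_family cox q_unit hH in
  let H0 := subalg (HI I0) in
  let XH := X_complex HI le in
  let XH0 := X_complex (sub_family HI I0) (induced_order (mem I0) le) in
  Kb_isomorphic
    (restrict_complex idfun (subalg_incl (B := HI I0)) XH
       : complex H H0)
    (tensor_complex
       (restrict idfun (subalg_incl (B := HI I0)) (regular_bimodule H))
       XH0).
Proof.
move=> HI H0 XH XH0.
(* The layers beyond the maximal length vanish, which gives the exponent. *)
apply: (@Kb_isomorphic_perturbation _ _ _ _ _ (hecke_proj_map cox q_unit hH le I0)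
  (hecke_contraction cox q_unit hH le I0) _ _ (\max_w cox_length S w).+1).
- exact: proj_map_surj.
- exact: proj_map_contraction.
- by move=> i x /proj_map_kernel x0; apply: deep_large (leqnn _) (iter_perturbation_deep _ x0).
- exact: X_Kb_object.
Qed.
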